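(* Let $\mathcal X,\mathcal Y,\mathcal Z$ be finite sets, $\mu$ a probability measure on $\mathcal X\times\mathcal Y$, and $f\colon\mathcal X\times\mathcal Y\to\mathcal Z$ with $\mathrm{IC}_\mu(f,\mu,0)>0$. Let $\alpha=\min_{(x,y)\in\mathrm{supp}\,\mu}\mu(x,y)$. Then for every $\epsilon\in[0,1]$, \[ \mathrm{IC}_\mu(f,\mu,0)-4|\mathcal X||\mathcal Y|\,\hat h(\sqrt{\epsilon/\alpha})\le \mathrm{IC}_\mu(f,\mu,\epsilon)\le \mathrm{IC}_\mu(f,\mu,0)-\frac{\alpha^2}{4}h(\epsilon\alpha/4)+3\epsilon\log_2|\mathcal X\times\mathcal Y|. \]
   Context: Two-party randomized protocols with public and private randomness; transcript $\Pi$ consists of public randomness and exchanged bits; $\pi(x,y)$ is the output. For $(X,Y)\sim\mu$, $\mathrm{IC}_\mu(\pi)=I(\Pi;X\mid Y)+I(\Pi;Y\mid X)$. For a distribution $\nu$ on $\mathcal X\times\mathcal Y$, a protocol performs $[f,\nu,\epsilon]$ if $\Pr_{(x,y)\sim\nu}[\pi(x,y)\ne f(x,y)]\le\epsilon$ (probability over the input and the protocol's randomness); $\mathrm{IC}_\mu(f,\nu,\epsilon)$ is the infimum of $\mathrm{IC}_\mu(\pi)$ over protocols performing $[f,\nu,\epsilon]$. $h$ is the binary entropy function (base 2) and $\hat h(x)=h(\min(x,1/2))$. *)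

(* Defs.v *)
From HB Require Import structures.
From mathcomp Require Import all_boot all_order all_algebra.
From mathcomp Require Import all_classical all_reals all_analysis.

Set Implicit Arguments.
Unset Strict Implicit.
Unset Printing Implicit Defensive.

Import Order.TTheory GRing.Theory Num.Theory.

Local Open Scope classical_set_scope.
Local Open Scope ring_scope.

(* A family of nonnegative reals with sum 1 has countable support, so this is
   an arbitrary discrete distribution; on a finType it is a probability
   vector. *)
Record dist (R : realType) (T : choiceType) := Dist {
  pmf :> T -> R;
  pmf_ge0 : forall t, 0 <= pmf t;
  pmf_sum1 : \esum_(t in [set: T]) (pmf t)%:E = 1%E }.

Section Information.
Context {R : realType}.

(* ln 0 = 0 in the library, so that 0 * log2 0 = 0. *)
Definition log2 (x : R) : R := ln x / ln 2.

Definition binent (x : R) : R := - (x * log2 x) - (1 - x) * log2 (1 - x).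

Definition binent_hat (x : R) : R := binent (Num.min x 2^-1).

Definition entropy (U : finType) (p : U -> R) : R :=
  - \sum_u p u * log2 (p u).

Section RandomVariables.
Variables (Om : choiceType) (P : Om -> R).

Definition Prob (E : set Om) : R := fine (\esum_(w in E) (P w)%:E).

(* H(A | C), the average over c of the entropy of the law of A given C = c;
   the values c of probability 0 contribute 0. *)
Definition cond_entropy (U : finType) (V : choiceType)
    (A : Om -> U) (C : Om -> V) : R :=
  fine (\esum_(c in [set: V])
    (Prob [set w | C w = c] *
     entropy (fun u => Prob [set w | A w = u /\ C w = c]
                       / Prob [set w | C w = c]))%:E).

(* I(W ; A | C) = H(A | C) - H(A | W, C).  The form H(W | C) - H(W | A, C) is
   avoided because H(W | C) can be infinite when W includes public
   randomness. *)
Definition cond_mutual_info (T : choiceType) (U : finType) (V : choiceType)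
    (W : Om -> T) (A : Om -> U) (C : Om -> V) : R :=
  cond_entropy A C - cond_entropy A (fun w => (W w, C w)).

End RandomVariables.
End Information.

(* The communication once the public randomness is fixed: at a node, its owner
   sends a bit computed from their private randomness and input, and the play
   moves to the first subtree on false and to the second on true.  Leaves carry
   the output, so the output is a function of the transcript. *)
Inductive ctree (X Y Z SA SB : Type) : Type :=
| Output of Z
| AliceSends of (SA -> X -> bool) & ctree X Y Z SA SB & ctree X Y Z SA SB
| BobSends of (SB -> Y -> bool) & ctree X Y Z SA SB & ctree X Y Z SA SB.

Section Run.
Context {X Y Z SA SB : Type}.
Variables (a : SA) (b : SB) (x : X) (y : Y).

Fixpoint bits (t : ctree X Y Z SA SB) : seq bool :=
  match t with
  | Output _ => [::]
  | AliceSends s t0 t1 =>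
      if s a x then true :: bits t1 else false :: bits t0
  | BobSends s t0 t1 =>
      if s b y then true :: bits t1 else false :: bits t0
  end.

Fixpoint output (t : ctree X Y Z SA SB) : Z :=
  match t with
  | Output z => z
  | AliceSends s t0 t1 => if s a x then output t1 else output t0
  | BobSends s t0 t1 => if s b y then output t1 else output t0
  end.

End Run.

(* The public randomness and the two private randomnesses are independent of
   each other and of the input, each with an arbitrary discrete distribution. *)
Record protocol (R : realType) (X Y Z : Type) := Protocol {
  Pub : choiceType;
  PrivA : choiceType;
  PrivB : choiceType;
  pub_dist : dist R Pub;
  privA_dist : dist R PrivA;
  privB_dist : dist R PrivB;
  comm : Pub -> ctree X Y Z PrivA PrivB }.

Section Protocols.
Context {R : realType} {X Y Z : finType}.

Section OneProtocol.
Variable pi : protocol R X Y Z.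

(* inputs, public randomness, private randomnesses *)
Definition space : choiceType :=
  (X * Y * Pub pi * PrivA pi * PrivB pi)%type.

Definition law (mu : dist R (X * Y)%type) (w : space) : R :=
  let: (x, y, r, a, b) := w in
  mu (x, y) * pub_dist pi r * privA_dist pi a * privB_dist pi b.

Definition inA (w : space) : X := let: (x, y, r, a, b) := w in x.
Definition inB (w : space) : Y := let: (x, y, r, a, b) := w in y.

Definition transcript (w : space) : Pub pi * seq bool :=
  let: (x, y, r, a, b) := w in (r, bits a b x y (comm r)).

Definition result (w : space) : Z :=
  let: (x, y, r, a, b) := w in output a b x y (comm r).

Definition IC (mu : dist R (X * Y)%type) : R :=
  cond_mutual_info (law mu) transcript inA inB +
  cond_mutual_info (law mu) transcript inB inA.

Definition performs (f : X -> Y -> Z) (nu : dist R (X * Y)%type) (eps : R) :=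
  Prob (law nu) [set w | result w <> f (inA w) (inB w)] <= eps.

End OneProtocol.

Definition ICf (mu : dist R (X * Y)%type) (f : X -> Y -> Z)
    (nu : dist R (X * Y)%type) (eps : R) : R :=
  inf [set v : R | exists pi : protocol R X Y Z,
                     performs pi f nu eps /\ v = IC pi mu].

(* The least probability of a point of the support; the neutral element 1
   does not affect the minimum, as probabilities are at most 1 and the support
   is nonempty. *)
Definition min_supp (mu : dist R (X * Y)%type) : R :=
  \big[Num.min/1]_(p : X * Y | 0 < mu p) mu p.

End Protocols.

(* Main.v *)
Require Import Defs.
From mathcomp Require Import all_boot all_order all_algebra.
From mathcomp Require Import all_classical all_reals all_analysis.
From mathcomp Require Import ring lra zify.

Set Implicit Arguments.
Unset Strict Implicit.
Unset Printing Implicit Defensive.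

Import Order.TTheory GRing.Theory Num.Theory.
Local Open Scope classical_set_scope.
Local Open Scope ring_scope.

(**
Write K_t(x,y) for the probability of the transcript t on inputs (x,y), and
ent2 M for H(X|Y) + H(Y|X) weighted by the mass of the unnormalized joint
vector M.  Then IC_mu(pi) = ent2(mu) - sum_t ent2(mu K_t), and ent2 is
homogeneous and superadditive; moreover K_t is a product of a function of x and
a function of y.

Upper bound.  If IC_mu(f,mu,0) > 0, then some y (up to exchanging the players)
is compatible with x0 and x1 such that f(x0,y) <> f(x1,y); otherwise Bob can
announce the value without revealing anything.  Alice privately replaces x0 by
x1 with probability d = eps alpha / 4.  Superadditivity bounds the loss by
d (log|X| + log|Y|), while on the transcripts of (x1,y), which zero error
forbids for (x0,y), the new atom x0 creates an uncertainty of at least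
alpha h(d).

Lower bound.  After a protocol with error eps, on transcript t, whenever (x,y) is
in the support of mu and contradicts the output, the player whose coordinate has
the smaller probability jointly with t reveals it, and then everything is
revealed.  By the rectangle property
P_t(x) P_t(y) = K_t(x,y) sum_(x',y') mu(x,y') mu(x',y) K_t(x',y'), so AM-GM
bounds the probability D that anything is revealed by q = sqrt(eps/alpha).  The
additional information is at most 2 h(D) + D log|X x Y|, where the entropy is
bounded by Gibbs' inequality with the reference value p = min(q,1/2).
*)

(** * Base-2 logarithms, the entropy term [eta], and binary entropy *)

Section Log.
Context {R : realType}.
Implicit Types a b p A B : R.

Lemma ln2_gt0 : 0 < ln 2 :> R.
Proof. by rewrite ln_gt0 // ltr1n. Qed.

Lemma ln_le_sub1 a : 0 < a -> ln a <= a - 1.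
Proof.
move=> a0; have := @le_ln1Dx R (a - 1).
rewrite (_ : 1 + (a - 1) = a); last by lra.
by apply; lra.
Qed.

Lemma ler_log2 a b : 0 < a -> a <= b -> log2 a <= log2 b.
Proof.
move=> a0 ab; rewrite /log2 ler_pM2r ?invr_gt0 ?ln2_gt0 //.
by rewrite ler_ln ?posrE // (lt_le_trans a0 ab).
Qed.

Lemma log2M a b : 0 < a -> 0 < b -> log2 (a * b) = log2 a + log2 b.
Proof. by move=> a0 b0; rewrite /log2 lnM ?posrE // mulrDl. Qed.

Lemma log2V a : 0 < a -> log2 a^-1 = - log2 a.
Proof. by move=> a0; rewrite /log2 lnV ?posrE // mulNr. Qed.

Lemma log2_1 : log2 1 = 0 :> R.
Proof. by rewrite /log2 ln1 mul0r. Qed.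

Lemma log2_2 : log2 2 = 1 :> R.
Proof. by rewrite /log2 divff // gt_eqF ?ln2_gt0. Qed.

Lemma log2_ge0 a : 1 <= a -> 0 <= log2 a.
Proof. by move=> a1; rewrite -log2_1 ler_log2. Qed.

Lemma log2_le0 a : 0 < a -> a <= 1 -> log2 a <= 0.
Proof. by move=> a0 a1; rewrite -log2_1 ler_log2. Qed.

(** This is [ln t <= t - 1] at [t = b / a]. The right-hand sides cancel when summed over two vectors
    of equal mass, which gives Gibbs' inequality. *)
Lemma gibbs_term a b : 0 <= a -> 0 < b ->
  a * (log2 b - log2 a) <= (b - a) / ln 2.
Proof.
move=> a0 b0; rewrite /log2 -mulrBl mulrA ler_pM2r ?invr_gt0 ?ln2_gt0 //.
have [->|an0] := eqVneq a 0; first by rewrite mul0r subr0 ltW.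
have {a0 an0}a0 : 0 < a by rewrite lt_neqAle eq_sym an0.
rewrite -ln_div ?posrE //.
have h := @ln_le_sub1 (b / a) (divr_gt0 b0 a0).
apply: (le_trans (ler_wpM2l (ltW a0) h)).
by rewrite mulrBr mulr1 mulrCA divff ?gt_eqF // mulr1.
Qed.

(** The share of an atom of mass [a] in the entropy of a vector of mass [A], multiplied by that
    mass. *)
Definition eta a A : R := a * (log2 A - log2 a).

Lemma eta0 A : eta 0 A = 0. Proof. by rewrite /eta mul0r. Qed.

Lemma eta_ge0 a A : 0 <= a -> a <= A -> 0 <= eta a A.
Proof.
rewrite le_eqVlt => /predU1P[<- _|]; first by rewrite eta0.
by move=> a0 aA; apply: mulr_ge0; [exact: ltW|rewrite subr_ge0 ler_log2].
Qed.

Lemma eta_scale c a A : 0 <= c -> 0 <= a -> a <= A ->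
  eta (c * a) (c * A) = c * eta a A.
Proof.
rewrite le_eqVlt => /predU1P[<- |c0]; first by rewrite !mul0r eta0.
rewrite le_eqVlt => /predU1P[<- |a0 aA]; first by rewrite mulr0 !eta0 mulr0.
have A0 := lt_le_trans a0 aA.
by rewrite /eta !log2M // -mulrA; congr (_ * (_ * _)); lra.
Qed.

Lemma eta_mono_r a A B : 0 <= a -> a <= A -> A <= B -> eta a A <= eta a B.
Proof.
rewrite le_eqVlt => /predU1P[<- |a0 aA AB]; first by rewrite !eta0.
by rewrite /eta ler_pM2l // lerB // ler_log2 // (lt_le_trans a0).
Qed.

(* the log-sum inequality, by comparing both logarithms with that of the mean
   ratio *)
Lemma eta_superadd a b A B : 0 <= a -> a <= A -> 0 <= b -> b <= B ->
  eta a A + eta b B <= eta (a + b) (A + B).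
Proof.
rewrite le_eqVlt => /predU1P[<- A0 b0 bB|a0 aA].
  by rewrite eta0 !add0r eta_mono_r // lerDr.
rewrite le_eqVlt => /predU1P[<- B0|b0 bB].
  by rewrite eta0 !addr0 eta_mono_r ?lerDl // ltW.
have A0 := lt_le_trans a0 aA; have B0 := lt_le_trans b0 bB.
have ab0 := addr_gt0 a0 b0; have AB0 := addr_gt0 A0 B0.
pose m := (a + b) / (A + B).
have m0 : 0 < m by rewrite divr_gt0.
have hA := @gibbs_term a (A * m) (ltW a0) (mulr_gt0 A0 m0).
have hB := @gibbs_term b (B * m) (ltW b0) (mulr_gt0 B0 m0).
have hs : A * m + B * m = a + b by rewrite -mulrDl mulrC divfK ?gt_eqF.
have hz : (A * m - a) / ln 2 + (B * m - b) / ln 2 = 0.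
  by rewrite -mulrDl (_ : _ + _ = 0) ?mul0r //; lra.
have hm : log2 m = log2 (a + b) - log2 (A + B).
  by rewrite /m log2M ?invr_gt0 // log2V.
clearbody m; have {}hA := lerD hA hB; rewrite hz !log2M // hm in hA.
rewrite /eta; lra.
Qed.

Lemma binent_ge0 p : 0 <= p <= 1 -> 0 <= binent p.
Proof.
have h (t : R) : 0 <= t <= 1 -> t * log2 t <= 0.
  case/andP; rewrite le_eqVlt => /predU1P[<- |t0 t1]; first by rewrite mul0r.
  by apply: mulr_ge0_le0; [exact: ltW|exact: log2_le0].
move=> hp; rewrite /binent.
have h1 : 0 <= 1 - p <= 1 by lra.
have := h p hp; have := h _ h1; lra.
Qed.

Lemma binent0 : binent 0 = 0 :> R.
Proof. by rewrite /binent subr0 mul0r log2_1; lra. Qed.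

Lemma binent_ge_id p : 0 < p -> p <= 2^-1 -> p <= binent p.
Proof.
move=> p0 p2; have : log2 p <= - 1 by rewrite -log2_2 -log2V // ler_log2.
have : log2 (1 - p) <= 0 by apply: log2_le0; lra.
rewrite /binent => h1 h2.
have : (1 - p) * log2 (1 - p) <= 0 by rewrite mulr_ge0_le0 //; lra.
have : p * log2 p <= p * (- 1) by rewrite ler_pM2l.
lra.
Qed.

(** After expansion the claim separates: [p / ln 2] lies between [- (1 - p) log2 (1 - p)] and
    [(1 + p) log2 (1 + p)]. *)
Lemma binent_le_eta p : 0 < p -> p < 1 -> binent p <= eta p (1 + p) + eta 1 (1 + p).
Proof.
move=> p0 p1; rewrite /eta /binent log2_1 subr0 mul1r.
suff : - ((1 - p) * log2 (1 - p)) <= (1 + p) * log2 (1 + p) by lra.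
have hq : 0 < 1 - p by lra.
have hr : 0 < 1 + p by lra.
have := @gibbs_term (1 - p) 1 (ltW hq) ltr01.
have := @gibbs_term (1 + p) 1 (ltW hr) ltr01.
rewrite !log2_1; lra.
Qed.

Lemma log2_natr_le n : log2 n.+1%:R <= n%:R :> R.
Proof.
elim: n => [|n IH]; first by rewrite log2_1.
have h : n.+2%:R <= 2 * n.+1%:R :> R by rewrite -natrM ler_nat; lia.
apply: (le_trans (ler_log2 _ h)); first by rewrite ltr0n.
rewrite log2M ?ltr0n // log2_2; apply: le_trans (lerD (lexx 1) IH) _.
by rewrite -nat1r.
Qed.

End Log.

(** * Entropy of unnormalized vectors on one alphabet *)

Section EntropyFunctional.
Context {R : realType} {U : finType}.
Implicit Types v w : U -> R.

(* the entropy of an unnormalized vector, multiplied by its mass *)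
Definition ent v : R := \sum_u eta (v u) (\sum_i v i).

Lemma le_mass v u : (forall i, 0 <= v i) -> v u <= \sum_i v i.
Proof. by move=> v0; rewrite (bigD1 u) //= lerDl sumr_ge0. Qed.

Lemma ent_ge0 v : (forall i, 0 <= v i) -> 0 <= ent v.
Proof. by move=> v0; apply: sumr_ge0 => u _; rewrite eta_ge0 ?le_mass. Qed.

Lemma eq_ent v w : v =1 w -> ent v = ent w.
Proof. by move=> /funext ->. Qed.

Lemma ent_scale c v : 0 <= c -> (forall i, 0 <= v i) ->
  ent (fun u => c * v u) = c * ent v.
Proof.
move=> c0 v0; rewrite /ent mulr_sumr; apply: eq_bigr => u _.
by rewrite -mulr_sumr eta_scale ?le_mass.
Qed.

(** Concavity of entropy in homogeneous form; it holds atom by atom by the log-sum inequality. *)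
Lemma ent_superadd v w : (forall i, 0 <= v i) -> (forall i, 0 <= w i) ->
  ent v + ent w <= ent (fun u => v u + w u).
Proof.
move=> v0 w0; rewrite /ent -big_split /=; apply: ler_sum => u _.
by rewrite big_split eta_superadd ?le_mass.
Qed.

(** Weighting by mass makes entropy monotone: by superadditivity the remainder [w - v] only adds. *)
Lemma le_ent v w : (forall i, 0 <= v i) -> (forall i, v i <= w i) ->
  ent v <= ent w.
Proof.
move=> v0 vw; rewrite (@eq_ent w (fun u => v u + (w u - v u))); last first.
  by move=> u; rewrite addrC subrK.
have h i : 0 <= w i - v i by rewrite subr_ge0.
by apply: le_trans (ent_superadd v0 h); rewrite lerDl ent_ge0.
Qed.

Lemma ent_le v : (forall i, 0 <= v i) -> ent v <= (\sum_i v i) * log2 #|U|%:R.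
Proof.
move=> v0; set S := \sum_i v i.
have [S0|Sn0] := eqVneq S 0.
  rewrite S0 mul0r /ent -/S big1 // => u _.
  have : v u = 0 by apply/le_anti; rewrite v0 andbT -S0 le_mass.
  by move=> ->; rewrite eta0.
have S0 : 0 < S by rewrite lt_neqAle eq_sym Sn0 sumr_ge0.
have n0 : 0 < #|U|%:R :> R.
  rewrite ltr0n lt0n; apply: contraNneq Sn0 => /card0_eq U0.
  by rewrite /S big1 // => u; have := U0 u.
have h u : eta (v u) S <= v u * log2 #|U|%:R + (S / #|U|%:R - v u) / ln 2.
  have := @gibbs_term R (v u) (S / #|U|%:R) (v0 u) (divr_gt0 S0 n0).
  by rewrite log2M ?invr_gt0 // log2V // /eta; lra.
rewrite /ent -/S; apply: le_trans (ler_sum _ (fun u _ => h u)) _.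
rewrite big_split /= -!mulr_suml -/S sumrB sumr_const -/S.
by rewrite -[S / _ *+ _]mulr_natr divfK ?gt_eqF // subrr mul0r addr0.
Qed.

(** Converse to superadditivity: mixing adds at most the entropy of the indicator of which vector
    was drawn. Its cross entropy with a fixed [p] is used instead, so that the bound is linear in
    the two masses and can be summed over transcripts. *)
Lemma ent_split v w p : 0 < p -> p < 1 ->
  (forall i, 0 <= v i) -> (forall i, 0 <= w i) ->
  ent (fun u => v u + w u) <= ent v + ent w
    - (\sum_i w i) * log2 p - (\sum_i v i) * log2 (1 - p).
Proof.
move=> p0 p1 v0 w0; set A := \sum_i v i; set B := \sum_i w i.
have A0 : 0 <= A by exact: sumr_ge0.
have B0 : 0 <= B by exact: sumr_ge0.
have [S0|Sn0] := eqVneq (A + B) 0.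
  have A00 : A = 0 by lra.
  have B00 : B = 0 by lra.
  rewrite A00 B00 !mul0r !subr0 (@eq_ent (fun u => v u + w u) (fun u => v u + 0)).
    rewrite (@eq_ent (fun u => v u + 0) v) ?lerDl ?ent_ge0 // => u.
    by rewrite addr0.
  move=> u; congr (_ + _); apply/le_anti; rewrite w0 andbT.
  by rewrite -B00 le_mass.
have S0 : 0 < A + B by rewrite lt_neqAle eq_sym Sn0 addr_ge0.
have q0 : 0 < 1 - p by lra.
have hg : A * (log2 (A + B) - log2 A) + B * (log2 (A + B) - log2 B) <=
          - B * log2 p - A * log2 (1 - p).
  have hA := @gibbs_term R A ((A + B) * (1 - p)) A0 (mulr_gt0 S0 q0).
  have hB := @gibbs_term R B ((A + B) * p) B0 (mulr_gt0 S0 p0).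
  have hz : ((A + B) * (1 - p) - A) / ln 2 + ((A + B) * p - B) / ln 2 = 0.
    by rewrite -mulrDl -(mul0r (ln 2)^-1); congr (_ * _); lra.
  have := lerD hA hB; rewrite hz !log2M //; lra.
have ht (a b : R) : 0 <= a -> 0 <= b ->
    - ((a + b) * log2 (a + b)) <= - (a * log2 a) - b * log2 b.
  rewrite le_eqVlt => /predU1P[<- _|a0].
    by rewrite !mul0r !add0r oppr0 add0r.
  rewrite le_eqVlt => /predU1P[<-|b0]; first by rewrite !mul0r !addr0 subr0.
  have h1 : log2 a <= log2 (a + b) by apply: ler_log2 => //; lra.
  have h2 : log2 b <= log2 (a + b) by apply: ler_log2 => //; lra.
  have : a * log2 a <= a * log2 (a + b) by rewrite ler_pM2l.
  have : b * log2 b <= b * log2 (a + b) by rewrite ler_pM2l.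
  lra.
have h u : eta (v u + w u) (A + B) <= eta (v u) A + eta (w u) B
   + v u * (log2 (A + B) - log2 A) + w u * (log2 (A + B) - log2 B).
  by have := ht _ _ (v0 u) (w0 u); rewrite /eta; lra.
rewrite {1}/ent big_split /=; apply: le_trans (ler_sum _ (fun u _ => h u)) _.
rewrite !big_split /= -!mulr_suml -/A -/B -/(ent v) -/(ent w).
by rewrite /ent -/A -/B; lra.
Qed.

(** The chain rule for the new atom [u0] against the old vector; afterwards only the uncertainty
    between [u0] and [u1] is kept. *)
Lemma ent_add_atom v u0 u1 m : u0 != u1 -> (forall i, 0 <= v i) -> v u0 = 0 ->
  0 <= m ->
  ent v + eta m (v u1 + m) + eta (v u1) (v u1 + m) <=
    ent (fun u => v u + (u == u0)%:R * m).
Proof.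
move=> u01 v0 vu0 m0; set S := \sum_i v i; set w := fun u => _.
have hS : \sum_i w i = S + m.
  rewrite big_split /=; congr (_ + _).
  rewrite (bigD1 u0) //= eqxx mul1r big1 ?addr0 // => i /negPf->.
  by rewrite mul0r.
have S1 : v u1 <= S by exact: le_mass.
have v10 := v0 u1.
have hS2 : eta S (S + m) = \sum_(u | u != u0) v u * (log2 (S + m) - log2 S).
  by rewrite /eta {1}/S (bigD1 u0) //= vu0 add0r mulr_suml.
have hent : ent w = ent v + eta m (S + m) + eta S (S + m).
  rewrite /ent hS -/S (bigD1 u0) //= [\sum_u eta (v u) _](bigD1 u0) //=.
  rewrite {1}/w eqxx mul1r vu0 add0r eta0 add0r addrAC addrC; congr (_ + _).
  rewrite hS2 -big_split /=.
  apply: eq_bigr => u /negPf uu0; rewrite /w uu0 mul0r addr0 /eta; lra.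
rewrite hent -!addrA lerD2l lerD //; first by apply: eta_mono_r => //; lra.
(* Superadditivity discards the other atoms, of mass [S - v u1], from the total [S + m]. *)
have hS1 : 0 <= S - v u1 by lra.
have := @eta_superadd R (v u1) (S - v u1) (v u1 + m) (S - v u1) v10.
rewrite (_ : v u1 + (S - v u1) = S); last by lra.
rewrite (_ : v u1 + m + (S - v u1) = S + m); last by lra.
move=> h; have := h _ hS1 (lexx _); have := eta_ge0 hS1 (lexx _); lra.
Qed.

End EntropyFunctional.

(** * Two-sided conditional entropy and the effect of noise on it *)

Section TwoSidedEntropy.
Context {R : realType}.

(* [H(X | Y) + H(Y | X)], weighted by the mass of the joint vector *)
Definition ent2 (X Y : finType) (M : X -> Y -> R) : R :=
  \sum_y ent (fun x => M x y) + \sum_x ent (M x).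

Lemma ent2_swap (X Y : finType) (M : X -> Y -> R) :
  ent2 (fun y x => M x y) = ent2 M.
Proof. exact: addrC. Qed.

Context {X Y : finType}.
Implicit Types M N : X -> Y -> R.

Lemma ent2_ge0 M : (forall x y, 0 <= M x y) -> 0 <= ent2 M.
Proof. by move=> M0; apply: addr_ge0; apply: sumr_ge0 => i _; exact: ent_ge0. Qed.

Lemma ent2_scale c M : 0 <= c -> (forall x y, 0 <= M x y) ->
  ent2 (fun x y => c * M x y) = c * ent2 M.
Proof.
move=> c0 M0; rewrite /ent2 mulrDr !mulr_sumr.
by congr (_ + _); apply: eq_bigr => i _; rewrite ent_scale.
Qed.

Lemma le_ent2 M N : (forall x y, 0 <= M x y) -> (forall x y, M x y <= N x y) ->
  ent2 M <= ent2 N.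
Proof. by move=> M0 MN; apply: lerD; apply: ler_sum => i _; exact: le_ent. Qed.

Lemma ent2_le M : (forall x y, 0 <= M x y) ->
  ent2 M <= (\sum_x \sum_y M x y) * (log2 #|X|%:R + log2 #|Y|%:R).
Proof.
move=> M0; rewrite mulrDr; apply: lerD.
  rewrite [X in _ <= X * _]exchange_big mulr_suml /=; apply: ler_sum => i _.
  exact: ent_le.
by rewrite mulr_suml /=; apply: ler_sum => i _; exact: ent_le.
Qed.

Lemma ent2_split M N p : 0 < p -> p < 1 ->
  (forall x y, 0 <= M x y) -> (forall x y, 0 <= N x y) ->
  ent2 (fun x y => M x y + N x y) <= ent2 M + ent2 N
    - 2 * (\sum_x \sum_y N x y) * log2 p
    - 2 * (\sum_x \sum_y M x y) * log2 (1 - p).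
Proof.
move=> p0 p1 M0 N0.
have h1 : \sum_y ent (fun x => M x y + N x y) <=
    \sum_y ent (fun x => M x y) + \sum_y ent (fun x => N x y)
    - (\sum_x \sum_y N x y) * log2 p - (\sum_x \sum_y M x y) * log2 (1 - p).
  rewrite [X in _ - X * _ - _]exchange_big [X in _ - _ - X * _]exchange_big /=.
  rewrite !mulr_suml -!sumrN -!big_split /=.
  by apply: ler_sum => i _; exact: ent_split.
have h2 : \sum_x ent (fun y => M x y + N x y) <=
    \sum_x ent (M x) + \sum_x ent (N x)
    - (\sum_x \sum_y N x y) * log2 p - (\sum_x \sum_y M x y) * log2 (1 - p).
  rewrite !mulr_suml -!sumrN -!big_split /=.
  by apply: ler_sum => i _; exact: ent_split.
rewrite /ent2; lra.
Qed.

Definition redirect (x0 x1 x : X) : X := if x == x0 then x1 else x.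

(* Mixing in the redirected channel costs at most the fraction d of the
   entropy; in column y the atom x0 reappears next to x1, where it was
   impossible before, and this restores uncertainty. *)
Lemma ent2_redirect (m K : X -> Y -> R) x0 x1 y0 al d :
  (forall x y, 0 <= m x y) -> (forall x y, 0 <= K x y) -> x0 != x1 ->
  0 <= al -> al <= m x0 y0 -> al <= m x1 y0 -> K x0 y0 * K x1 y0 = 0 ->
  0 < d -> d < 1 ->
  (1 - d) * ent2 (fun x y => m x y * K x y) + al * binent d * K x1 y0 <=
  ent2 (fun x y => m x y * ((1 - d) * K x y + d * K (redirect x0 x1 x) y)).
Proof.
move=> m0 K0 x01 al0 al_x0 al_x1 KK d0 d1.
set M := fun x y => m x y * K x y.
set N := fun x y => m x y * K (redirect x0 x1 x) y.
have M0 x y : 0 <= M x y by exact: mulr_ge0.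
have N0 x y : 0 <= N x y by exact: mulr_ge0.
have e0 : 0 <= 1 - d by lra.
have d0' := ltW d0.
have hcol (U : finType) (u v : U -> R) : (forall i, 0 <= u i) -> (forall i, 0 <= v i) ->
    (1 - d) * ent u <= ent (fun i => (1 - d) * u i + d * v i).
  move=> u0 v0; rewrite -ent_scale //.
  by apply: le_ent => i; [exact: mulr_ge0|rewrite lerDl mulr_ge0].
have -> : (fun x y => m x y * ((1 - d) * K x y + d * K (redirect x0 x1 x) y)) =
    (fun x y => (1 - d) * M x y + d * N x y).
  by apply/funext => x; apply/funext => y; rewrite /M /N; ring.
rewrite /ent2 mulrDr addrAC lerD //; last first.
  by rewrite mulr_sumr; apply: ler_sum => x _; exact: hcol.
rewrite (bigD1 y0) //= [leRHS](bigD1 y0) //= mulrDr addrAC lerD //; last first.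
  by rewrite mulr_sumr; apply: ler_sum => y _; apply: hcol.
(* If [K x1 y0 = 0], no gain is claimed; otherwise [KK] forces [K x0 y0 = 0], so that the atom [x0]
   is new in column [y0]. *)
have [K10|K1n0] := eqVneq (K x1 y0) 0.
  by rewrite K10 mulr0 addr0; apply: hcol.
have K00 : K x0 y0 = 0 by move/eqP: KK; rewrite mulf_eq0 (negPf K1n0) orbF => /eqP.
have K1_ge0 := K0 x1 y0.
have -> : (fun x => (1 - d) * M x y0 + d * N x y0) =
    (fun x => M x y0 + (x == x0)%:R * (d * m x0 y0 * K x1 y0)).
  apply/funext => x; rewrite /M /N /redirect.
  by case: eqP => [->|_]; rewrite ?K00 /=; ring.
have M00 : M x0 y0 = 0 by rewrite /M K00 mulr0.
have n0 : 0 <= d * m x0 y0 * K x1 y0 by rewrite !mulr_ge0.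
have := @ent_add_atom _ _ (fun x => M x y0) _ _ _ x01 (fun x => M0 x y0) M00 n0.
have hk : 0 <= al * K x1 y0 by exact: mulr_ge0.
have hn : al * K x1 y0 * d <= d * m x0 y0 * K x1 y0.
  by rewrite mulrAC [d * _]mulrC; do 2! apply: ler_wpM2r => //.
have hM : al * K x1 y0 <= M x1 y0 by exact: ler_wpM2r.
(* [eta a (b + a)] increases in both [a] and [b], so [m x0 y0] and [m x1 y0] may be lowered to
   [al]. *)
have hs (a b a' b' : R) : 0 <= a -> 0 <= b -> a <= a' -> b <= b' ->
    eta a (b + a) <= eta a' (b' + a').
  move=> a00 b00 aa bb.
  have h : eta a (b + a) + eta (a' - a) ((b' - b) + (a' - a)) <= eta a' (b' + a').
    have e1 : b + a + (b' - b + (a' - a)) = b' + a' by lra.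
    have e2 : a + (a' - a) = a' by lra.
    have := @eta_superadd R a (a' - a) (b + a) (b' - b + (a' - a)).
    by rewrite e1 e2; apply; lra.
  by apply: le_trans h; rewrite lerDl eta_ge0 //; lra.
have hd : 0 <= al * K x1 y0 * d by exact: mulr_ge0.
have g1 := hs _ _ _ _ hd hk hn hM.
have := hs _ _ _ _ hk hd hM hn; rewrite ![_ + M x1 y0]addrC => g2.
have s1 : eta (al * K x1 y0 * d) (al * K x1 y0 + al * K x1 y0 * d)
    = al * K x1 y0 * eta d (1 + d).
  by rewrite -eta_scale ?mulrDr ?mulr1 //; lra.
have s2 : eta (al * K x1 y0) (al * K x1 y0 * d + al * K x1 y0)
    = al * K x1 y0 * eta 1 (1 + d).
  by rewrite -eta_scale ?mulrDr ?mulr1 1?addrC //; lra.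
have hb : al * K x1 y0 * binent d <= al * K x1 y0 * (eta d (1 + d) + eta 1 (1 + d)).
  by apply: ler_wpM2l => //; exact: binent_le_eta.
have hE : (1 - d) * ent (fun x => M x y0) <= ent (fun x => M x y0).
  have := ent_ge0 (fun x => M0 x y0); nra.
rewrite s1 in g1; rewrite s2 in g2; 
set bd := binent d in hb *; clearbody bd; rewrite mulrDr in hb; lra.
Qed.

(** * Entropy lost when some inputs are revealed *)

Section Reveal.
Variables (M : X -> Y -> R) (A : pred X) (B : pred Y).
Hypothesis M0 : forall x y, 0 <= M x y.

Definition hidden (x : X) (y : Y) : bool := ~~ A x && ~~ B y.

(** The revealed part gets the trivial bound [ent2_le]. Writing the hidden mass as total minus
    revealed mass makes [log2 (1 - p)] occur twice. *)
Lemma ent2_reveal p : 0 < p -> p < 1 ->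
  ent2 M <= ent2 (fun x y => (hidden x y)%:R * M x y)
    + (\sum_x \sum_y (~~ hidden x y)%:R * M x y)
      * (log2 #|X|%:R + log2 #|Y|%:R - 2 * log2 p + 2 * log2 (1 - p))
    - 2 * (\sum_x \sum_y M x y) * log2 (1 - p).
Proof.
move=> p0 p1.
set N := fun x y => (hidden x y)%:R * M x y.
set W := fun x y => (~~ hidden x y)%:R * M x y.
have N0 x y : 0 <= N x y by rewrite mulr_ge0.
have W0 x y : 0 <= W x y by rewrite mulr_ge0.
have MNW x y : M x y = N x y + W x y.
  by rewrite /N /W; case: hidden; rewrite /= mul1r mul0r ?addr0 ?add0r.
have MNW2 : M = fun x y => N x y + W x y.
  by apply/funext => x; apply/funext => y.
have hsum : \sum_x \sum_y M x y = \sum_x \sum_y N x y + \sum_x \sum_y W x y.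
  rewrite -big_split; apply: eq_bigr => x _; rewrite -big_split /=.
  by apply: eq_bigr => y _.
rewrite hsum -/(\sum_x \sum_y W x y).
have := ent2_split p0 p1 N0 W0; have := ent2_le W0; rewrite -MNW2; lra.
Qed.

End Reveal.

(** * The revealed mass under a rectangular kernel *)

Section RevealedMass.
Variables (m K : X -> Y -> R) (c : X -> Y -> bool).
Hypothesis m0 : forall x y, 0 <= m x y.
Hypothesis K0 : forall x y, 0 <= K x y.
Hypothesis Krect : forall x y x' y', K x y * K x' y' = K x y' * K x' y.

Let M x y := m x y * K x y.
Let Px x := \sum_y M x y.
Let Py y := \sum_x M x y.

(* the owner of the less likely coordinate reveals it *)
Definition exposedA : pred X := fun x => [exists y, c x y && (Px x <= Py y)].
Definition exposedB : pred Y := fun y => [exists x, c x y && (Py y < Px x)].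

(** Each exposed coordinate is charged to a pair of [c] at which its marginal is the smaller one, so
    the revealed mass is at most the sum of [min (Px x) (Py y)] over the pairs of [c]. The rectangle
    property and AM-GM with weight [q] bound each minimum. *)
Lemma revealed_mass q : 0 < q ->
  \sum_x \sum_y (~~ hidden exposedA exposedB x y)%:R * M x y <=
  (\sum_x \sum_y (c x y)%:R * K x y) * (q^-1 / 2)
  + (\sum_x \sum_y \sum_x' \sum_y' m x y' * m x' y * K x' y') * (q / 2).
Proof.
move=> q0.
have M0 x y : 0 <= M x y by exact: mulr_ge0.
have Px0 x : 0 <= Px x by exact: sumr_ge0.
have Py0 y : 0 <= Py y by exact: sumr_ge0.
pose lo x y := (c x y)%:R * Num.min (Px x) (Py y).
have lo0 x y : 0 <= lo x y by rewrite mulr_ge0 // le_min Px0 Py0.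
pose loA x y := (c x y && (Px x <= Py y))%:R * Px x.
pose loB x y := (c x y && (Py y < Px x))%:R * Py y.
have lo_split x y : loA x y + loB x y = lo x y.
  rewrite /loA /loB /lo; case: (c x y); rewrite /= ?mul0r ?addr0 //.
  by case: leP => _; rewrite !(mul1r, mul0r, addr0, add0r).
apply: (@le_trans _ _ (\sum_x \sum_y lo x y)).
  have h x y : (~~ hidden exposedA exposedB x y)%:R * M x y <=
      (exposedA x)%:R * M x y + (exposedB y)%:R * M x y.
    rewrite /hidden negb_and !negbK -mulrDl; apply: ler_wpM2r => //.
    by case: (exposedA x); case: (exposedB y); rewrite /= ?addr0 ?add0r // lerDl.
  apply: le_trans (ler_sum _ (fun x _ => ler_sum _ (fun y _ => h x y))) _.
  under eq_bigr do rewrite big_split.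
  rewrite big_split /=; under [leRHS]eq_bigr do under eq_bigr do rewrite -lo_split.
  under [leRHS]eq_bigr do rewrite big_split.
  rewrite [leRHS]big_split /=; apply: lerD.
    apply: ler_sum => x _; rewrite -mulr_sumr -/(Px x).
    rewrite /exposedA; case: existsP => [[y hy]|_]; last first.
      by rewrite mul0r sumr_ge0 // => y _; rewrite mulr_ge0.
    by rewrite (bigD1 y) //= {1}/loA hy lerDl sumr_ge0 // => ? _; rewrite mulr_ge0.
  rewrite exchange_big [leRHS]exchange_big /=.
  apply: ler_sum => y _; rewrite -mulr_sumr -/(Py y).
  rewrite /exposedB; case: existsP => [[x hx]|_]; last first.
    by rewrite mul0r sumr_ge0 // => x _; rewrite mulr_ge0.
  by rewrite (bigD1 x) //= {1}/loB hx lerDl sumr_ge0 // => ? _; rewrite mulr_ge0.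
rewrite !mulr_suml -big_split; apply: ler_sum => x _.
rewrite /= !mulr_suml -big_split; apply: ler_sum => y _ /=.
set Q := \sum_x' _.
have Q0 : 0 <= Q.
  by apply: sumr_ge0 => ? _; apply: sumr_ge0 => ? _; rewrite !mulr_ge0.
rewrite /lo; case: (c x y); last by rewrite !mul0r add0r mulr_ge0 // divr_ge0 // ltW.
(* Swapping coordinates by [Krect] pulls the factor [K x y] out of the product of the marginals. *)
have hPQ : Px x * Py y = K x y * Q.
  rewrite mulrC /Px /Py mulr_suml /Q [RHS]mulr_sumr; apply: eq_bigr => x' _.
  rewrite !mulr_sumr; apply: eq_bigr => y' _; rewrite /M.
  transitivity (m x y' * m x' y * (K x y' * K x' y)); first by ring.
  by rewrite -Krect; ring.
rewrite !mul1r; set u := Num.min _ _.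
have uP : u <= Px x by rewrite ge_min lexx.
have uQ : u <= Py y by rewrite ge_min lexx orbT.
have u0 : 0 <= u by rewrite le_min Px0 Py0.
have uu : u * u <= K x y * Q by rewrite -hPQ ler_pM.
have a0 : 0 <= K x y / q by rewrite divr_ge0 // ltW.
have b0 : 0 <= q * Q by rewrite mulr_ge0 // ltW.
have hab : K x y * Q = (K x y / q) * (q * Q) by rewrite mulrA divfK ?gt_eqF.
rewrite hab in uu.
(* AM-GM for the factors [K x y / q] and [q * Q], whose product bounds [u * u]. *)
suff : u <= (K x y / q + q * Q) / 2 by lra.
move: a0 b0 uu; move: (K x y / q) (q * Q) => a b a0 b0 uu.
rewrite -(@ler_sqr _ u) ?nnegrE ?divr_ge0 ?addr_ge0 //.
by rewrite !expr2; apply: (le_trans uu); have := sqr_ge0 (a - b); rewrite expr2; lra.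
Qed.

End RevealedMass.
End TwoSidedEntropy.

(** * Finite sums of nonnegative families over discrete types *)

Section Sums.
Context {R : realType}.

(** Bundling nonnegativity with a finite value lets extended-real sums be handled as real
    numbers. *)
Definition sums_to (T : choiceType) (F : T -> R) (s : R) : Prop :=
  (forall t, 0 <= F t) /\ \esum_(t in [set: T]) (F t)%:E = s%:E.

Lemma sums_to_ge0 (T : choiceType) (F : T -> R) s : sums_to F s -> 0 <= s.
Proof. by move=> [F0 Fs]; rewrite -lee_fin -Fs; apply: esum_ge0 => t _; rewrite lee_fin. Qed.

Lemma sums_to_uniq (T : choiceType) (F : T -> R) a b :
  sums_to F a -> sums_to F b -> a = b.
Proof. by move=> [_ Fa] [_]; rewrite Fa => -[]. Qed.

Lemma sums_to_fine (T : choiceType) (F : T -> R) s : sums_to F s ->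
  fine (\esum_(t in [set: T]) (F t)%:E) = s.
Proof. by move=> [_ ->]. Qed.

Lemma eq_sums_to (T : choiceType) (F G : T -> R) s : F =1 G ->
  sums_to F s -> sums_to G s.
Proof. by move=> /funext ->. Qed.

Lemma sums_to0 (T : choiceType) : sums_to (fun _ : T => 0) 0.
Proof. by split=> //; exact: esum1. Qed.

Lemma sums_toD (T : choiceType) (F G : T -> R) a b :
  sums_to F a -> sums_to G b -> sums_to (fun t => F t + G t) (a + b).
Proof.
move=> [F0 Fa] [G0 Gb]; split=> [t|]; first exact: addr_ge0.
rewrite EFinD -Fa -Gb -esumD => [|t _|t _]; rewrite ?lee_fin //.
Qed.

Lemma sums_toZ (T : choiceType) (F : T -> R) c s : 0 <= c ->
  sums_to F s -> sums_to (fun t => c * F t) (c * s).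
Proof.
(* Finite partial sums give one inequality for any factor; using it again with [c^-1] gives the
   reverse one. *)
have hle (G : T -> R) (e : R) : 0 <= e -> (forall t, 0 <= G t) ->
    (\esum_(t in [set: T]) (e * G t)%:E <= e%:E * \esum_(t in [set: T]) (G t)%:E)%E.
  move=> e0 G0; apply: ge_ereal_sup => _ [A [finA _] <-].
  under eq_fsbigr do rewrite EFinM.
  rewrite -ge0_mule_fsumr; last by move=> t; rewrite lee_fin.
  apply: lee_wpmul2l; first by rewrite lee_fin.
  by apply: ereal_sup_ubound; exists A.
rewrite le_eqVlt => /predU1P[<- _|c0 [F0 Fs]].
  by rewrite mul0r; apply: eq_sums_to (sums_to0 T) => t; rewrite mul0r.
have cF0 t : 0 <= c * F t by rewrite mulr_ge0 // ltW.
split=> //; apply/le_anti/andP; split.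
  by rewrite EFinM -Fs; apply: hle => //; exact: ltW.
rewrite EFinM -Fs.
have := hle (fun t => c * F t) c^-1; rewrite invr_ge0 => /(_ (ltW c0) cF0).
under eq_esum do rewrite mulKf ?gt_eqF //.
move=> /(@lee_wpmul2l R c%:E); rewrite lee_fin => /(_ (ltW c0)) /le_trans; apply.
by rewrite muleA -EFinM divff ?gt_eqF // mul1e.
Qed.

Lemma sums_to_sum (T : choiceType) (I : finType) (F : I -> T -> R) (s : I -> R) :
  (forall i, sums_to (F i) (s i)) ->
  sums_to (fun t => \sum_i F i t) (\sum_i s i).
Proof.
move=> h; split=> [t|]; first by apply: sumr_ge0 => i _; case: (h i).
under eq_esum do rewrite -sumEFin.
rewrite esum_sum => [|t i _ _]; last by rewrite lee_fin; case: (h i).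
by rewrite -sumEFin; apply: eq_bigr => i _; case: (h i).
Qed.

Lemma sums_to_le (T : choiceType) (F G : T -> R) a b :
  sums_to F a -> sums_to G b -> (forall t, F t <= G t) -> a <= b.
Proof.
move=> [F0 Fa] [G0 Gb] FG; rewrite -lee_fin -Fa -Gb.
by apply: le_esum => t _; rewrite lee_fin.
Qed.

Lemma sums_to_bounded (T : choiceType) (F : T -> R) b :
  (forall t, 0 <= F t) -> (\esum_(t in [set: T]) (F t)%:E <= b%:E)%E ->
  exists2 a, sums_to F a & a <= b.
Proof.
move=> F0 hb; have h0 : (0 <= \esum_(t in [set: T]) (F t)%:E)%E.
  by apply: esum_ge0 => t _; rewrite lee_fin.
have hfin : \esum_(t in [set: T]) (F t)%:E \is a fin_num.
  by rewrite ge0_fin_numE // (le_lt_trans hb) ?ltry.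
exists (fine (\esum_(t in [set: T]) (F t)%:E)); first by split=> //; rewrite fineK.
by rewrite -lee_fin fineK.
Qed.

Lemma sums_to_dominated (T : choiceType) (F G : T -> R) b :
  (forall t, 0 <= F t) -> (forall t, F t <= G t) -> sums_to G b ->
  exists2 a, sums_to F a & a <= b.
Proof.
move=> F0 FG [G0 Gb]; apply: sums_to_bounded => //.
by rewrite -Gb; apply: le_esum => t _; rewrite lee_fin.
Qed.

Lemma sums_to_pair (T U : choiceType) (F : T -> U -> R) (g : T -> R) s :
  (forall t, sums_to (F t) (g t)) -> sums_to g s ->
  sums_to (fun p : T * U => F p.1 p.2) s.
Proof.
move=> h [g0 gs]; split=> [p|]; first by case: (h p.1).
rewrite -gs; have -> : [set: T * U] = [set: T] `*`` (fun=> [set: U]).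
  by apply/seteqP; split.
rewrite -(@esum_esum R T U [set: T] (fun=> [set: U]) (fun t u => (F t u)%:E)).
  by apply: eq_esum => t _; case: (h t).
by move=> t u _ _; rewrite lee_fin; case: (h t).
Qed.

Lemma sums_to_prod (T U : choiceType) (F : T -> R) (G : U -> R) a b :
  sums_to F a -> sums_to G b ->
  sums_to (fun p : T * U => F p.1 * G p.2) (a * b).
Proof.
move=> hF hG; apply: (@sums_to_pair _ _ (fun t u => F t * G u) (fun t => F t * b)).
  by move=> t; apply: sums_toZ => //; case: hF.
apply: (@eq_sums_to _ (fun t => b * F t)) => [t|]; first exact: mulrC.
by rewrite mulrC; apply: sums_toZ => //; exact: sums_to_ge0 hG.
Qed.

Lemma sums_to_reindex (T U : choiceType) (e : T -> U) (F : U -> R) s :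
  bijective e -> sums_to (fun t => F (e t)) s <-> sums_to F s.
Proof.
move=> be; have [g ge eg] := be.
have he : \esum_(u in [set: U]) (F u)%:E = \esum_(t in [set: T]) (F (e t))%:E.
  apply: reindex_esum; split=> //; first by move=> a b _ _; exact: (bij_inj be).
  by move=> u _; exists (g u).
split=> -[h0 hs]; split=> //; last by rewrite -he.
  by move=> u; rewrite -(eg u).
by rewrite he.
Qed.

(** An injective map picks distinct terms of [F]. This serves to compare sums over the transcripts
    of two different protocols. *)
Lemma sums_to_sub (T U : choiceType) (S : set T) (e : T -> U) (F : U -> R) s :
  set_inj S e -> sums_to F s ->
  exists2 a, sums_to (fun t => (t \in S)%:R * F (e t)) a & a <= s.
Proof.
move=> inj [F0 Fs]; apply: sums_to_bounded => [t|]; first by rewrite mulr_ge0.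
have -> : \esum_(t in [set: T]) ((t \in S)%:R * F (e t))%:E =
    \esum_(u in e @` S) (F u)%:E.
  rewrite esum_image // [RHS]esum_mkcond; apply: eq_esum => t _.
  by case: (t \in S); rewrite ?mul1r ?mul0r.
rewrite esum_mkcond -Fs; apply: le_esum => u _.
by case: ifP; rewrite lee_fin.
Qed.

Lemma sums_to_fin (T : finType) (F : T -> R) : (forall t, 0 <= F t) ->
  sums_to F (\sum_t F t).
Proof.
move=> F0; split=> //; rewrite esum_fset; [|exact: finite_finset|by move=> t _; rewrite lee_fin].
have -> : [set: T] = [set` index_enum T].
  by apply/seteqP; split=> // t _; exact: mem_index_enum.
by rewrite -fsbig_seq ?index_enum_uniq // sumEFin.
Qed.

Lemma dist_sums_to (T : choiceType) (p : dist R T) : sums_to p 1.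
Proof. by split; [exact: Defs.pmf_ge0|exact: pmf_sum1]. Qed.

End Sums.

(** * Probabilities and conditional entropies as sums *)

Section Probability.
Context {R : realType}.
Variables (Om : choiceType) (P : Om -> R).
Variable s : R.
Hypothesis Ps : sums_to P s.

Lemma Prob_sums_to (E : set Om) : sums_to (fun w => (w \in E)%:R * P w) (Prob P E).
Proof.
have P0 : forall w, 0 <= P w by case: Ps.
have h0 w : 0 <= (w \in E)%:R * P w by rewrite mulr_ge0.
have hle w : (w \in E)%:R * P w <= P w by rewrite ler_piMl //; case: (w \in E).
have [a [_ ha] _] := sums_to_dominated h0 hle Ps.
have hE : \esum_(w in E) (P w)%:E = \esum_(w in [set: Om]) ((w \in E)%:R * P w)%:E.
  by rewrite esum_mkcond; apply: eq_esum => w _; case: (w \in E); rewrite ?mul1r ?mul0r.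
by rewrite /Prob hE ha.
Qed.

Lemma Prob_eq (E : set Om) p : sums_to (fun w => (w \in E)%:R * P w) p -> Prob P E = p.
Proof. exact: (sums_to_uniq (Prob_sums_to E)). Qed.

Lemma Prob_ge0 (E : set Om) : 0 <= Prob P E.
Proof. exact: sums_to_ge0 (Prob_sums_to E). Qed.

Lemma le_Prob (E F : set Om) : E `<=` F -> Prob P E <= Prob P F.
Proof.
move=> EF; apply: sums_to_le (Prob_sums_to E) (Prob_sums_to F) _ => w.
apply: ler_wpM2r; first by case: Ps.
by rewrite ler_nat; case: (boolP (w \in E)) => // /set_mem /EF /mem_set ->.
Qed.

Lemma Prob_set0 : Prob P set0 = 0.
Proof. by rewrite /Prob esum_set0. Qed.

Lemma Prob_setT : Prob P [set: Om] = s.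
Proof. by rewrite /Prob; case: Ps => _ ->. Qed.

Lemma Prob_fiber (V : choiceType) (T : Om -> V) (E : set Om) :
  sums_to (fun v => Prob P [set w | E w /\ T w = v]) (Prob P E).
Proof.
have P0 : forall w, 0 <= P w by case: Ps.
split=> [v|]; first exact: Prob_ge0.
have [Q0 Qs] := Prob_sums_to E; rewrite -Qs.
pose Q w := ((w \in E)%:R * P w)%:E.
have hQ w : (0 <= Q w)%E by rewrite lee_fin.
transitivity (\esum_(v in [set: V]) \esum_(w in [set w | T w = v]) Q w).
  apply: eq_esum => v _; have [_ <-] := Prob_sums_to [set w | E w /\ T w = v].
  rewrite [RHS]esum_mkcond; apply: eq_esum => w _; rewrite /Q.
  have -> : (w \in [set w | E w /\ T w = v]) = (w \in E) && (w \in [set w | T w = v]).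
    by apply/idP/andP => [/set_mem[/mem_set ? ?]|[/set_mem ? /set_mem ?]];
      [split=> //; exact: mem_set | exact: mem_set].
  by case: (w \in E); case: (w \in [set w | T w = v]); rewrite /= ?mul0r.
(* The pairs [(v, w)] with [T w = v] form the graph of [T], which is indexed by [w]. *)
rewrite (@esum_esum R V Om [set: V] (fun v => [set w | T w = v]) (fun _ w => Q w)) //.
apply: (@reindex_esum R Om (V * Om)%type [set: Om] _ (fun w => (T w, w)) (fun k => Q k.2)).
by split=> [w _ //|w w' _ _ [_ //]|[v w] [_ /= <-]]; exists w.
Qed.

Lemma Prob_fiber_fin (U : finType) (A : Om -> U) (E : set Om) :
  Prob P E = \sum_u Prob P [set w | E w /\ A w = u].
Proof.
by apply: sums_to_uniq (Prob_fiber A E) (sums_to_fin _) => u; exact: Prob_ge0.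
Qed.

(** The probability of [c] times the entropy of the conditional law is the mass-weighted [ent] of
    the joint vector; both vanish when that probability is 0. *)
Lemma cond_entropyE (U : finType) (V : choiceType) (A : Om -> U) (C : Om -> V) v :
  sums_to (fun c => ent (fun u => Prob P [set w | A w = u /\ C w = c])) v ->
  cond_entropy P A C = v.
Proof.
move=> hv; rewrite /cond_entropy -(sums_to_fine hv); congr fine.
apply: eq_esum => c _; congr EFin.
have hp : \sum_u Prob P [set w | A w = u /\ C w = c] = Prob P [set w | C w = c].
  rewrite (Prob_fiber_fin A); apply: eq_bigr => u _; congr Prob.
  by apply/seteqP; split=> w /= -[].
set p := Prob P [set w | C w = c] in hp *.
set q := fun u => Prob P [set w | A w = u /\ C w = c] in hp *.
have q0 u : 0 <= q u by exact: Prob_ge0.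
have p0 : 0 <= p by exact: Prob_ge0.
have [p00|pn0] := eqVneq p 0.
  rewrite p00 mul0r /ent big1 // => u _.
  suff -> : q u = 0 by rewrite eta0.
  by apply/le_anti; rewrite q0 -p00 -hp le_mass.
have pp : 0 < p by rewrite lt_neqAle eq_sym pn0.
rewrite /entropy /ent mulrN mulr_sumr -sumrN; apply: eq_bigr => u _.
rewrite hp /= -/p -/(q u) [p * _]mulrA [p * _]mulrCA divff // mulr1 /eta.
have := q0 u; rewrite le_eqVlt => /predU1P[<-|qp]; first by rewrite !mul0r oppr0.
by rewrite log2M ?invr_gt0 // log2V //; ring.
Qed.

End Probability.

(** * Transcripts of protocol trees and their rectangle structure *)

Section Trees.
Context {X Y Z SA SB : Type}.
Implicit Types t : ctree X Y Z SA SB.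

(** Only Alice's bits are tested, Bob's are followed as given, and [s] must end exactly at a leaf.
    One such condition per player makes each transcript event a rectangle. *)
Fixpoint agreesA t (s : seq bool) (a : SA) (x : X) : bool :=
  match t, s with
  | Output _, [::] => true
  | AliceSends g t0 t1, c :: s' =>
      (g a x == c) && agreesA (if c then t1 else t0) s' a x
  | BobSends g t0 t1, c :: s' => agreesA (if c then t1 else t0) s' a x
  | _, _ => false
  end.

Fixpoint agreesB t (s : seq bool) (b : SB) (y : Y) : bool :=
  match t, s with
  | Output _, [::] => true
  | AliceSends g t0 t1, c :: s' => agreesB (if c then t1 else t0) s' b y
  | BobSends g t0 t1, c :: s' =>
      (g b y == c) && agreesB (if c then t1 else t0) s' b y
  | _, _ => false
  end.

Lemma bits_agrees t s a b x y :
  (bits a b x y t == s) = agreesA t s a x && agreesB t s b y.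
Proof.
elim: t s => [z|g t0 IH0 t1 IH1|g t0 IH0 t1 IH1] [|c s] //=.
- by case: (g a x); rewrite ?andbF.
- by case: (g a x); case: c; rewrite /= ?eqseq_cons /= -?IH0 -?IH1.
- by case: (g b y); rewrite ?andbF.
- by case: (g b y); case: c; rewrite /= ?eqseq_cons /= -?IH0 -?IH1 ?andbF.
Qed.

Fixpoint leaf t (s : seq bool) : Z :=
  match t with
  | Output z => z
  | AliceSends _ t0 t1 | BobSends _ t0 t1 =>
      if s is c :: s' then leaf (if c then t1 else t0) s' else leaf t0 [::]
  end.

Lemma output_leaf t a b x y : output a b x y t = leaf t (bits a b x y t).
Proof. by elim: t => //= g t0 IH0 t1 IH1; case: ifP. Qed.

(** Transcripts form a prefix code, so they can still be recovered after further messages are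
    appended. *)
Lemma bits_prefix_free t a b x y a' b' x' y' w w' :
  bits a b x y t ++ w = bits a' b' x' y' t ++ w' ->
  bits a b x y t = bits a' b' x' y' t.
Proof.
elim: t => //= g t0 IH0 t1 IH1; do 2! case: ifP => _ //=.
- by move=> [/IH1 ->].
- by move=> [/IH0 ->].
- by move=> [/IH1 ->].
- by move=> [/IH0 ->].
Qed.

End Trees.

(** * The transcript channel, information cost and error *)

Section Channel.
Context {R : realType} {X Y Z : finType}.
Implicit Types (pi : protocol R X Y Z) (mu : dist R (X * Y)%type).

Definition rand pi (u : Pub pi * PrivA pi * PrivB pi) : R :=
  pub_dist pi u.1.1 * privA_dist pi u.1.2 * privB_dist pi u.2.

Lemma rand_sums_to pi : sums_to (rand (pi := pi)) 1.
Proof.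
rewrite -[X in sums_to _ X](mulr1 1) -[X in X * 1](mulr1 1).
apply: (@sums_to_prod R _ _ (fun ra => pub_dist pi ra.1 * privA_dist pi ra.2)) => //.
  by apply: sums_to_prod; exact: dist_sums_to.
exact: dist_sums_to.
Qed.

Definition trans pi (x : X) (y : Y) (u : Pub pi * PrivA pi * PrivB pi) :
  Pub pi * seq bool := (u.1.1, bits u.1.2 u.2 x y (comm u.1.1)).

(** The [K_t(x,y)] of the overview. *)
Definition chan pi x y (t : Pub pi * seq bool) : R :=
  Prob (rand (pi := pi)) [set u | trans x y u = t].

Lemma chan_ge0 pi x y t : 0 <= chan (pi := pi) x y t.
Proof. exact: Prob_ge0 (rand_sums_to pi) _. Qed.

Lemma chan_sums_to pi x y : sums_to (chan (pi := pi) x y) 1.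
Proof.
have := Prob_fiber (rand_sums_to pi) (trans x y) setT.
rewrite (Prob_setT (rand_sums_to pi)); apply: eq_sums_to => t.
by congr Prob; apply/seteqP; split=> u //= -[].
Qed.

Lemma chan_neq0 pi x y t : chan (pi := pi) x y t != 0 ->
  exists u, trans x y u = t.
Proof.
move=> h; apply: contrapT => hn; move/eqP: h; apply.
rewrite /chan (_ : [set u | _] = set0) ?Prob_set0 //.
by apply/seteqP; split=> u //= hu; apply: hn; exists u.
Qed.

Definition chanA pi (t : Pub pi * seq bool) (x : X) : R :=
  Prob (privA_dist pi) [set a | agreesA (comm t.1) t.2 a x].

Definition chanB pi (t : Pub pi * seq bool) (y : Y) : R :=
  Prob (privB_dist pi) [set b | agreesB (comm t.1) t.2 b y].

(** The three sources of randomness are independent, and by [bits_agrees] the event that the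
    transcript is [t] imposes a separate condition on each. *)
Lemma chanE pi x y t :
  chan (pi := pi) x y t = pub_dist pi t.1 * chanA t x * chanB t y.
Proof.
case: t => r s.
apply: (Prob_eq (rand_sums_to pi)).
have hp : sums_to (fun r' => (r' \in [set r])%:R * pub_dist pi r') (pub_dist pi r).
  have -> : pub_dist pi r = Prob (pub_dist pi) [set r].
    by rewrite /Prob esum_set1 // lee_fin Defs.pmf_ge0.
  exact: Prob_sums_to (dist_sums_to _) _.
have hA := Prob_sums_to (dist_sums_to (privA_dist pi)) [set a | agreesA (comm r) s a x].
have hB := Prob_sums_to (dist_sums_to (privB_dist pi)) [set b | agreesB (comm r) s b y].
apply: eq_sums_to (sums_to_prod (sums_to_prod hp hA) hB) => -[[r' a] b] /=.
have -> : ((r', a, b) \in [set u | trans x y u = (r, s)]) =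
    (r' \in [set r]) && ((a \in [set a | agreesA (comm r) s a x]) &&
       (b \in [set b | agreesB (comm r) s b y])).
  apply/idP/and3P => [/set_mem[/= <- /eqP]|[/set_mem/= -> /set_mem /= ha /set_mem /= hb]].
    by rewrite bits_agrees => /andP[ha hb]; split; apply: mem_set.
  by apply: mem_set; rewrite /trans /=; congr (_, _); apply/eqP; rewrite bits_agrees ha hb.
rewrite /rand /=; case: (r' \in _); case: (a \in _); case: (b \in _); rewrite /=; ring.
Qed.

Lemma chan_rect pi x y x' y' t : chan (pi := pi) x y t * chan x' y' t =
  chan x y' t * chan x' y t.
Proof. by rewrite !chanE; ring. Qed.

Lemma law_sums_to pi mu : sums_to (law (pi := pi) mu) 1.
Proof.
pose e (q : (X * Y) * (Pub pi * PrivA pi * PrivB pi)) : Defs.space pi :=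
  (q.1, q.2.1.1, q.2.1.2, q.2.2).
have be : bijective e.
  exists (fun w => (w.1.1.1, (w.1.1.2, w.1.2, w.2))) => [[p [[r a] b]] //|].
  by move=> [[[p r] a] b].
apply/(sums_to_reindex _ _ be).
have := sums_to_prod (dist_sums_to mu) (rand_sums_to pi).
rewrite mulr1; apply: eq_sums_to => -[[x y] [[r a] b]].
by rewrite /rand /=; ring.
Qed.

Lemma Prob_law pi mu (E : set (Defs.space pi)) : Prob (law mu) E =
  \sum_x \sum_y mu (x, y) *
     Prob (rand (pi := pi)) [set u | E (x, y, u.1.1, u.1.2, u.2)].
Proof.
pose e (q : (X * Y) * (Pub pi * PrivA pi * PrivB pi)) : Defs.space pi :=
  (q.1, q.2.1.1, q.2.1.2, q.2.2).
have be : bijective e.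
  exists (fun w => (w.1.1.1, (w.1.1.2, w.1.2, w.2))) => [[p [[r a] b]] //|].
  by move=> [[[p r] a] b].
apply: (Prob_eq (law_sums_to pi mu)); apply/(sums_to_reindex _ _ be).
rewrite pair_bigA /=.
pose F (p : X * Y) u := mu p * ((u \in [set u | E (p, u.1.1, u.1.2, u.2)])%:R * rand (pi := pi) u).
apply: (@eq_sums_to _ _ (fun q => F q.1 q.2)).
  move=> [[x y] [[r a] b]]; rewrite /F /rand /=.
  have -> : ((r, a, b) \in [set u | E (x, y, u.1.1, u.1.2, u.2)]) =
      (e ((x, y), (r, a, b)) \in E).
    by apply/idP/idP => /set_mem h; exact: mem_set.
  by ring.
apply: sums_to_pair (fun p => mu p * Prob (rand (pi := pi))
  [set u | E (p, u.1.1, u.1.2, u.2)]) _ _ _.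
  by move=> p; apply: sums_toZ; [exact: Defs.pmf_ge0|exact: Prob_sums_to (rand_sums_to pi) _].
have -> : \sum_p mu (p.1, p.2) * Prob (rand (pi := pi)) [set u | E (p.1, p.2, u.1.1, u.1.2, u.2)]
   = \sum_p mu p * Prob (rand (pi := pi)) [set u | E (p, u.1.1, u.1.2, u.2)].
  by apply: eq_bigr => -[].
by apply: sums_to_fin => p; rewrite mulr_ge0 ?Defs.pmf_ge0 // (Prob_ge0 (rand_sums_to pi)).
Qed.

Lemma Prob_inputs pi mu x y : Prob (law mu) [set w : Defs.space pi | inA w = x /\ inB w = y] =
  mu (x, y).
Proof.
rewrite Prob_law (bigD1 x) //= [X in _ + X]big1 ?addr0 => [|x' x'x]; last first.
  rewrite big1 // => y' _; rewrite (_ : [set u | _] = set0) ?Prob_set0 ?mulr0 //.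
  by apply/seteqP; split=> u //= -[xx _]; rewrite xx eqxx in x'x.
rewrite (bigD1 y) //= [X in _ + X]big1 ?addr0 => [|y' y'y]; last first.
  rewrite (_ : [set u | _] = set0) ?Prob_set0 ?mulr0 //.
  by apply/seteqP; split=> u //= -[_ yy]; rewrite yy eqxx in y'y.
rewrite (_ : [set u | _] = setT) ?(Prob_setT (rand_sums_to pi)) ?mulr1 //.
by apply/seteqP; split.
Qed.

Lemma Prob_joint pi mu x y t :
  Prob (law mu) [set w : Defs.space pi | [/\ inA w = x, inB w = y & transcript w = t]] =
  mu (x, y) * chan x y t.
Proof.
rewrite Prob_law (bigD1 x) //= [X in _ + X]big1 ?addr0 => [|x' x'x]; last first.
  rewrite big1 // => y' _; rewrite (_ : [set u | _] = set0) ?Prob_set0 ?mulr0 //.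
  by apply/seteqP; split=> u //= -[xx _ _]; rewrite xx eqxx in x'x.
rewrite (bigD1 y) //= [X in _ + X]big1 ?addr0 => [|y' y'y]; last first.
  rewrite (_ : [set u | _] = set0) ?Prob_set0 ?mulr0 //.
  by apply/seteqP; split=> u //= -[_ yy _]; rewrite yy eqxx in y'y.
congr (_ * Prob _ _).
by apply/seteqP; split=> u /= => [[]|].
Qed.

Lemma dist_total mu : \sum_x \sum_y mu (x, y) = 1.
Proof.
rewrite pair_bigA /= -[RHS](sums_to_uniq (sums_to_fin (Defs.pmf_ge0 mu)) (dist_sums_to mu)).
by apply: eq_bigr => -[].
Qed.

Lemma joint_ge0 pi mu x y t : 0 <= mu (x, y) * chan (pi := pi) x y t.
Proof. by rewrite mulr_ge0 ?Defs.pmf_ge0 ?chan_ge0. Qed.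

Lemma joint_mass_sums_to pi mu :
  sums_to (fun t => \sum_x \sum_y mu (x, y) * chan (pi := pi) x y t) 1.
Proof.
rewrite -(dist_total mu); apply: sums_to_sum => x; apply: sums_to_sum => y.
by rewrite -[mu _ in X in sums_to _ X]mulr1; apply: sums_toZ (chan_sums_to _ _ _);
  exact: Defs.pmf_ge0.
Qed.

(** Summed over [t], this is [H(X | Y, Pi) + H(Y | X, Pi)]. *)
Definition residual pi mu (t : Pub pi * seq bool) : R :=
  ent2 (fun x y => mu (x, y) * chan x y t).

Lemma log2_card_ge0 (T : finType) : 0 <= log2 #|T|%:R :> R.
Proof.
case: #|T| => [|n]; last by rewrite log2_ge0 // ler1n.
by rewrite /log2 ln0 // mul0r.
Qed.

(** Information cost is initial minus residual uncertainty. The bound on [v] yields a lower bound on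
    the cost that is uniform in [pi], as the infimum requires. *)
Lemma IC_residual pi mu : exists v,
  [/\ sums_to (residual (pi := pi) mu) v,
      IC pi mu = ent2 (fun x y => mu (x, y)) - v &
      v <= log2 #|X|%:R + log2 #|Y|%:R].
Proof.
pose C : R := log2 #|X|%:R + log2 #|Y|%:R.
have C0 : 0 <= C by rewrite addr_ge0 ?log2_card_ge0.
have J0 x y t : 0 <= mu (x, y) * chan (pi := pi) x y t by exact: joint_ge0.
pose FA t y := ent (fun x => mu (x, y) * chan (pi := pi) x y t).
pose FB t x := ent (fun y => mu (x, y) * chan (pi := pi) x y t).
have FA0 t y : 0 <= FA t y by exact: ent_ge0.
have FB0 t x : 0 <= FB t x by exact: ent_ge0.
(* The residual is dominated by [C] times the transcript mass, so its two halves are summable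
   separately. *)
have hC : sums_to (fun t => C * \sum_x \sum_y mu (x, y) * chan (pi := pi) x y t) C.
  by rewrite -[X in sums_to _ X]mulr1; apply: sums_toZ (joint_mass_sums_to _ _).
have hle t : residual mu t <= C * \sum_x \sum_y mu (x, y) * chan (pi := pi) x y t.
  by rewrite mulrC; exact: ent2_le.
have sA0 t : 0 <= \sum_y FA t y by exact: sumr_ge0.
have sB0 t : 0 <= \sum_x FB t x by exact: sumr_ge0.
have [a ha _] : exists2 a, sums_to (fun t => \sum_y FA t y) a & a <= C.
  apply: sums_to_dominated hC => // t; apply: le_trans (hle t).
  by rewrite /residual /ent2 lerDl; exact: sB0.
have [b hb _] : exists2 b, sums_to (fun t => \sum_x FB t x) b & b <= C.
  apply: sums_to_dominated hC => // t; apply: le_trans (hle t).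
  by rewrite /residual /ent2 lerDr; exact: sA0.
have hab := sums_toD ha hb.
exists (a + b); split=> //; last exact: sums_to_le hab hC hle.
have hAB : cond_entropy (law (pi := pi) mu) (@inA _ _ _ _ pi) (@inB _ _ _ _ pi)
  = \sum_y ent (fun x => mu (x, y)).
  apply: (cond_entropyE (law_sums_to pi mu)).
  apply: (@eq_sums_to _ _ (fun y => ent (fun x => mu (x, y)))).
    by move=> y; apply: eq_ent => x; rewrite Prob_inputs.
  by apply: sums_to_fin => y; apply: ent_ge0 => x; exact: Defs.pmf_ge0.
have hBA : cond_entropy (law (pi := pi) mu) (@inB _ _ _ _ pi) (@inA _ _ _ _ pi)
  = \sum_x ent (fun y => mu (x, y)).
  apply: (cond_entropyE (law_sums_to pi mu)).
  apply: (@eq_sums_to _ _ (fun x => ent (fun y => mu (x, y)))).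
    move=> x; apply: eq_ent => y; rewrite -(Prob_inputs pi).
    by congr Prob; apply/seteqP; split=> w /= [].
  by apply: sums_to_fin => y; apply: ent_ge0 => x; exact: Defs.pmf_ge0.
have hA : cond_entropy (law (pi := pi) mu) (@inA _ _ _ _ pi) (fun w => (transcript w, inB w)) = a.
  apply: (cond_entropyE (law_sums_to pi mu)).
  apply: (@eq_sums_to _ _ (fun q => FA q.1 q.2)).
    move=> [t y]; apply: eq_ent => x; rewrite -Prob_joint.
    by congr Prob; apply/seteqP; split=> w /= => [[? ? ?]|[? [? ?]]]; do ?split=> //; congr (_, _).
  by apply: sums_to_pair ha => t; exact: sums_to_fin.
have hB : cond_entropy (law (pi := pi) mu) (@inB _ _ _ _ pi) (fun w => (transcript w, inA w)) = b.
  apply: (cond_entropyE (law_sums_to pi mu)).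
  apply: (@eq_sums_to _ _ (fun q => FB q.1 q.2)).
    move=> [t x]; apply: eq_ent => y; rewrite -Prob_joint.
    by congr Prob; apply/seteqP; split=> w /= => [[? ? ?]|[? [? ?]]]; do ?split=> //; congr (_, _).
  by apply: sums_to_pair hb => t; exact: sums_to_fin.
rewrite /IC /cond_mutual_info hAB hBA hA hB /ent2; ring.
Qed.

Definition wrong pi (f : X -> Y -> Z) (t : Pub pi * seq bool) x y : bool :=
  leaf (comm t.1) t.2 != f x y.

(** The output is a function of the transcript, so the error probability splits over transcripts. *)
Lemma performsP pi f mu eps : performs pi f mu eps <->
  exists2 e, sums_to (fun t => \sum_x \sum_y
      (wrong f t x y)%:R * (mu (x, y) * chan (pi := pi) x y t)) e & e <= eps.
Proof.
have h : sums_to (fun t => \sum_x \sum_y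
      (wrong f t x y)%:R * (mu (x, y) * chan (pi := pi) x y t))
    (Prob (law mu) [set w : Defs.space pi | result w <> f (inA w) (inB w)]).
  apply: eq_sums_to (Prob_fiber (law_sums_to pi mu) (@transcript _ _ _ _ pi) _) => t.
  rewrite Prob_law; apply: eq_bigr => x _; apply: eq_bigr => y _.
  rewrite mulrCA; congr (_ * _); rewrite /wrong.
  case: eqP => hw /=; rewrite ?mul0r ?mul1r /chan.
    rewrite (_ : [set u | _] = set0) ?Prob_set0 //.
    apply/seteqP; split=> -[[r a] b] //= -[ho ht]; apply: ho.
    by rewrite -hw -ht /= output_leaf.
  congr Prob; apply/seteqP; split=> -[[r a] b] /= => [[]//|ht]; split=> //.
  by rewrite output_leaf => ho; apply: hw; rewrite -ho -ht.
split=> [hp|[e he ee]];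
  first by exists (Prob (law mu) [set w : Defs.space pi | result w <> f (inA w) (inB w)]).
by rewrite /performs (sums_to_uniq h he).
Qed.

End Channel.

(** * Distributions for the constructed protocols *)

Section Distributions.
Context {R : realType}.

Definition dist_of (T : choiceType) (p : T -> R) (hp : sums_to p 1) : dist R T :=
  Dist (proj1 hp) (proj2 hp).

Lemma bernoulli_sums_to (d : R) : 0 <= d <= 1 ->
  sums_to (fun c : bool => if c then d else 1 - d) 1.
Proof.
move=> /andP[d0 d1].
have e : \sum_(c : bool) (if c then d else 1 - d) = 1 by rewrite big_bool /=; lra.
by rewrite -[X in sums_to _ X]e; apply: sums_to_fin => -[] //; lra.
Qed.

Definition bernoulli_dist (d : R) (hd : 0 <= d <= 1) := dist_of (bernoulli_sums_to hd).

Lemma prod_dist_sums_to (T U : choiceType) (p : dist R T) (q : dist R U) :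
  sums_to (fun w : T * U => p w.1 * q w.2) 1.
Proof.
by rewrite -[X in sums_to _ X](mulr1 1); apply: sums_to_prod; exact: dist_sums_to.
Qed.

Definition prod_dist (T U : choiceType) (p : dist R T) (q : dist R U) :=
  dist_of (prod_dist_sums_to p q).

Lemma unit_sums_to : sums_to (fun _ : unit => 1 : R) 1.
Proof.
have e : \sum_(u : unit) 1 = 1 :> R by rewrite sumr_const card_unit.
by rewrite -[X in sums_to _ X]e; exact: sums_to_fin.
Qed.

Definition unit_dist : dist R unit := dist_of unit_sums_to.

Lemma sums_to_delta (T : choiceType) (t0 : T) (c : R) : 0 <= c ->
  sums_to (fun t => (t == t0)%:R * c) c.
Proof.
move=> c0; split=> [t|]; first by rewrite mulr_ge0.
transitivity (\esum_(t in [set t0]) c%:E); last by rewrite esum_set1.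
rewrite [RHS]esum_mkcond; apply: eq_esum => t _.
have -> : (t \in [set t0]) = (t == t0).
  by apply/idP/eqP => [/set_mem //|->]; exact: mem_set.
by case: (t == t0); rewrite ?mul1r ?mul0r.
Qed.

Lemma Prob_prod_bool (T : choiceType) (p : dist R T) (q : dist R bool)
    (E : bool -> set T) :
  Prob (prod_dist p q) [set w | E w.2 w.1] = \sum_c q c * Prob p (E c).
Proof.
apply: (Prob_eq (dist_sums_to (prod_dist p q))).
have be : bijective (fun w : bool * T => (w.2, w.1)).
  by exists (fun w => (w.2, w.1)) => -[].
apply/(sums_to_reindex _ _ be).
pose F c a := q c * ((a \in E c)%:R * p a).
apply: (@eq_sums_to _ _ (fun w => F w.1 w.2)).
  move=> [c a]; rewrite /F /=.
  have -> : ((a, c) \in [set w | E w.2 w.1]) = (a \in E c).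
    by apply/idP/idP => /set_mem h; exact: mem_set.
  by ring.
apply: sums_to_pair (sums_to_fin _) => c.
  by apply: sums_toZ; [exact: Defs.pmf_ge0|exact: Prob_sums_to (dist_sums_to p) _].
by rewrite mulr_ge0 ?Defs.pmf_ge0 // (Prob_ge0 (dist_sums_to p)).
Qed.

End Distributions.

(** * Protocols with privately noisy players *)

Section Relabel.
Context {X Y Z SA SB : Type}.
Variables (fA : X -> X) (fB : Y -> Y).

(** The added private bit decides whether its owner plays throughout as if holding the image of the
    input under [fA] or [fB]. *)
Fixpoint relabel (t : ctree X Y Z SA SB) : ctree X Y Z (SA * bool) (SB * bool) :=
  match t with
  | Output z => Output _ _ _ _ z
  | AliceSends g t0 t1 =>
      AliceSends (fun a x => g a.1 (if a.2 then fA x else x)) (relabel t0) (relabel t1)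
  | BobSends g t0 t1 =>
      BobSends (fun b y => g b.1 (if b.2 then fB y else y)) (relabel t0) (relabel t1)
  end.

Lemma agreesA_relabel t s a x :
  agreesA (relabel t) s a x = agreesA t s a.1 (if a.2 then fA x else x).
Proof.
by elim: t s => [z|g t0 IH0 t1 IH1|g t0 IH0 t1 IH1] [|[] s] //=; rewrite ?IH0 ?IH1.
Qed.

Lemma agreesB_relabel t s b y :
  agreesB (relabel t) s b y = agreesB t s b.1 (if b.2 then fB y else y).
Proof.
by elim: t s => [z|g t0 IH0 t1 IH1|g t0 IH0 t1 IH1] [|[] s] //=; rewrite ?IH0 ?IH1.
Qed.

Lemma leaf_relabel t s : leaf (relabel t) s = leaf t s.
Proof.
by elim: t s => [z|g t0 IH0 t1 IH1|g t0 IH0 t1 IH1] [|[] s] //=; rewrite ?IH0 ?IH1.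
Qed.

End Relabel.

Section Noise.
Context {R : realType} {X Y Z : finType}.
Variables (pi : protocol R X Y Z) (fA : X -> X) (fB : Y -> Y).
Variables (dA dB : R) (hA : 0 <= dA <= 1) (hB : 0 <= dB <= 1).

Definition noisy : protocol R X Y Z :=
  @Protocol R X Y Z _ _ _ (pub_dist pi)
    (prod_dist (privA_dist pi) (bernoulli_dist hA))
    (prod_dist (privB_dist pi) (bernoulli_dist hB))
    (fun r => relabel fA fB (comm r)).

(** By [chanE] the channel has one factor per player, and each private coin averages its own
    factor. *)
Lemma chan_noisy x y (t : Pub pi * seq bool) : chan (pi := noisy) x y t =
  dA * (dB * chan (pi := pi) (fA x) (fB y) t + (1 - dB) * chan (pi := pi) (fA x) y t) +
  (1 - dA) * (dB * chan (pi := pi) x (fB y) t + (1 - dB) * chan (pi := pi) x y t).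
Proof.
rewrite !chanE.
have -> : chanA (pi := noisy) t x = dA * chanA (pi := pi) t (fA x)
  + (1 - dA) * chanA (pi := pi) t x.
  pose E c := [set a | agreesA (@comm _ _ _ _ pi t.1) t.2 a (if c then fA x else x)].
  transitivity (Prob (privA_dist noisy) [set w | E w.2 w.1]).
    by congr Prob; apply/seteqP; split=> a; rewrite /E /= agreesA_relabel.
  by rewrite Prob_prod_bool big_bool.
have -> : chanB (pi := noisy) t y = dB * chanB (pi := pi) t (fB y)
  + (1 - dB) * chanB (pi := pi) t y.
  pose E c := [set b | agreesB (@comm _ _ _ _ pi t.1) t.2 b (if c then fB y else y)].
  transitivity (Prob (privB_dist noisy) [set w | E w.2 w.1]).
    by congr Prob; apply/seteqP; split=> b; rewrite /E /= agreesB_relabel.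
  by rewrite Prob_prod_bool big_bool.
rewrite /=; ring.
Qed.

Lemma wrong_noisy f (t : Pub pi * seq bool) : wrong (pi := noisy) f t = wrong (pi := pi) f t.
Proof. by apply/funext => x; apply/funext => y; rewrite /wrong leaf_relabel. Qed.

End Noise.

(** * Announcing values and appending messages *)

Section Questions.
Context {X Y Z SA SB : Type}.
Local Notation tree := (ctree X Y Z SA SB).

(** One yes/no question per element of [l], up to the first yes; [k] continues from the announced
    value, [d] applies when the value is not in [l]. *)
Fixpoint askA (T : eqType) (l : seq T) (g : X -> T) (k : T -> tree) (d : tree) :=
  if l is c :: l' then
    AliceSends (fun _ x => g x == c) (askA l' g k d) (k c)
  else d.

Fixpoint askB (T : eqType) (l : seq T) (g : Y -> T) (k : T -> tree) (d : tree) :=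
  if l is c :: l' then
    BobSends (fun _ y => g y == c) (askB l' g k d) (k c)
  else d.

Lemma bits_askA (T : eqType) (l : seq T) g k d a b x y :
  bits a b x y (askA l g k d) =
    if g x \in l then nseq (index (g x) l) false ++ true :: bits a b x y (k (g x))
    else nseq (size l) false ++ bits a b x y d.
Proof.
elim: l => //= c l IH; rewrite inE [c == _]eq_sym; case: eqP => [<-|_] //=.
by rewrite IH; case: ifP.
Qed.

Lemma bits_askB (T : eqType) (l : seq T) g k d a b x y :
  bits a b x y (askB l g k d) =
    if g y \in l then nseq (index (g y) l) false ++ true :: bits a b x y (k (g y))
    else nseq (size l) false ++ bits a b x y d.
Proof.
elim: l => //= c l IH; rewrite inE [c == _]eq_sym; case: eqP => [<-|_] //=.
by rewrite IH; case: ifP.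
Qed.

Lemma output_askA (T : eqType) (l : seq T) g k d a b x y :
  output a b x y (askA l g k d) =
    if g x \in l then output a b x y (k (g x)) else output a b x y d.
Proof. by elim: l => //= c l IH; rewrite inE; case: eqP => [<-|_] //=. Qed.

Lemma output_askB (T : eqType) (l : seq T) g k d a b x y :
  output a b x y (askB l g k d) =
    if g y \in l then output a b x y (k (g y)) else output a b x y d.
Proof. by elim: l => //= c l IH; rewrite inE; case: eqP => [<-|_] //=. Qed.

(** The continuation receives the bits sent so far and replaces the leaf reached. *)
Fixpoint extend (t : tree) (k : seq bool -> tree) : tree :=
  match t with
  | Output _ => k [::]
  | AliceSends g t0 t1 =>
      AliceSends g (extend t0 (fun s => k (false :: s))) (extend t1 (fun s => k (true :: s)))
  | BobSends g t0 t1 =>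
      BobSends g (extend t0 (fun s => k (false :: s))) (extend t1 (fun s => k (true :: s)))
  end.

Lemma bits_extend t k a b x y : bits a b x y (extend t k) =
  bits a b x y t ++ bits a b x y (k (bits a b x y t)).
Proof.
by elim: t k => //= g t0 IH0 t1 IH1 k; case: ifP; rewrite ?IH0 ?IH1.
Qed.

Lemma output_extend t k a b x y : output a b x y (extend t k) =
  output a b x y (k (bits a b x y t)).
Proof.
by elim: t k => //= g t0 IH0 t1 IH1 k; case: ifP; rewrite ?IH0 ?IH1.
Qed.

End Questions.

(** * Upper bound: noise saves information *)

Section Bounds.
Context {R : realType} {X Y Z : finType}.
Variables (mu : dist R (X * Y)%type) (f : X -> Y -> Z).
Implicit Types pi : protocol R X Y Z.

Lemma dist_inhabited : exists p, 0 < mu p.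
Proof.
apply: contrapT => hn; have : \sum_p mu p = 1.
  exact: sums_to_uniq (sums_to_fin (Defs.pmf_ge0 mu)) (dist_sums_to mu).
rewrite big1 => [/eqP|p _]; first by rewrite eq_sym oner_eq0.
apply/eqP/negPn/negP => hp; apply: hn; exists p.
by rewrite lt_neqAle eq_sym hp Defs.pmf_ge0.
Qed.

Lemma performs0_wrong pi t x y : performs pi f mu 0 ->
  wrong (pi := pi) f t x y -> mu (x, y) * chan x y t = 0.
Proof.
move=> /performsP[e he e0] hw.
have h0 s x' y' : 0 <= (wrong (pi := pi) f s x' y')%:R * (mu (x', y') * chan x' y' s).
  by apply: mulr_ge0 => //; exact: joint_ge0.
have hd : (mu (x, y) * chan x y t) <= e.
  apply: sums_to_le (sums_to_delta t (joint_ge0 _ _ _ _)) he _ => s.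
  rewrite (bigD1 x) //= (bigD1 y) //= -addrA.
  have hr : 0 <= \sum_(i | i != y) (wrong (pi := pi) f s x i)%:R * (mu (x, i) * chan x i s)
     + \sum_(i | i != x) \sum_j (wrong (pi := pi) f s i j)%:R * (mu (i, j) * chan i j s).
    by apply: addr_ge0; apply: sumr_ge0 => // i _; apply: sumr_ge0.
  case: eqP hr => [->|_] hr; first by rewrite hw !mul1r lerDl.
  by rewrite mul0r addr_ge0.
apply/le_anti/andP; split; [exact: le_trans hd e0|exact: joint_ge0].
Qed.

(** Without conflicts, [f] on the support depends on [x] alone and also on [y] alone. Both players
    know Bob's announcement beforehand, so the residual equals the initial uncertainty. *)
Lemma silent_protocol :
  (forall x x' y, 0 < mu (x, y) -> 0 < mu (x', y) -> f x y = f x' y) ->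
  (forall x y y', 0 < mu (x, y) -> 0 < mu (x, y') -> f x y = f x y') ->
  exists pi, performs pi f mu 0 /\ IC pi mu = 0.
Proof.
move=> hx hy; have [[x0 y0] _] := dist_inhabited; pose z0 := f x0 y0.
(* The default [z0] serves inputs of marginal probability 0. *)
pose gB y := if [pick x | 0 < mu (x, y)] is Some x then f x y else z0.
pose gA x := if [pick y | 0 < mu (x, y)] is Some y then f x y else z0.
have gBE x y : 0 < mu (x, y) -> gB y = f x y.
  rewrite /gB; case: pickP => [x' hx'|h]; last by rewrite h.
  by move=> hp; exact: hx.
have gAE x y : 0 < mu (x, y) -> gA x = f x y.
  rewrite /gA; case: pickP => [y' hy'|h]; last by rewrite h.
  by move=> hp; exact: hy.
pose tr : ctree X Y Z unit unit :=
  askB (enum Z) gB (fun z => Output _ _ _ _ z) (Output _ _ _ _ z0).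
pose pi : protocol R X Y Z :=
  @Protocol R X Y Z unit unit unit (unit_dist (R := R)) (unit_dist (R := R))
     (unit_dist (R := R)) (fun _ => tr).
pose code z : unit * seq bool := (tt, nseq (index z (enum Z)) false ++ [:: true]).
have trE x y u : trans (pi := pi) x y u = code (gB y).
  rewrite /trans /code /= /tr bits_askB mem_enum /=.
  by congr (_, _); case: u.1.1.
have chE x y t : chan (pi := pi) x y t = (t == code (gB y))%:R.
  rewrite /chan; case: eqP => [->|hn].
    rewrite (_ : [set u | _] = setT) ?(Prob_setT (rand_sums_to pi)) //.
    by apply/seteqP; split=> u //= _; exact: trE.
  rewrite (_ : [set u | _] = set0) ?Prob_set0 //.
  by apply/seteqP; split=> u //= hu; apply: hn; rewrite -hu trE.
have mu0 p : mu p = 0 \/ 0 < mu p.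
  by have := Defs.pmf_ge0 mu p; rewrite le_eqVlt => /predU1P[<-|]; [left|right].
exists pi; split.
  apply/performsP; exists 0 => //.
  apply: eq_sums_to (sums_to0 _) => t; rewrite big1 // => x _; rewrite big1 // => y _.
  rewrite chE; have [->|hp] := mu0 (x, y); first by rewrite mul0r mulr0.
  case: eqP => [->|_]; last by rewrite !mulr0.
  rewrite /wrong /= -[leaf _ _](_ : output tt tt x y tr = _).
    by rewrite output_askB mem_enum /= (gBE x) // eqxx mul0r.
  by rewrite output_leaf /tr bits_askB mem_enum.
have [v [hv -> _]] := IC_residual pi mu.
apply/eqP; rewrite subr_eq0; apply/eqP; apply: sums_to_uniq hv.
(* In the second sum the transcript is expressed through [gA], which agrees with [gB] on the
   support. *)
apply: (@eq_sums_to _ _ (fun t => \sum_y (t == code (gB y))%:R * ent (fun x => mu (x, y))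
    + \sum_x (t == code (gA x))%:R * ent (fun y => mu (x, y)))).
  move=> t; rewrite /residual /ent2; congr (_ + _); apply: eq_bigr => i _.
    rewrite -ent_scale // => [|x]; last exact: Defs.pmf_ge0.
    by apply: eq_ent => x; rewrite chE mulrC.
  rewrite -ent_scale // => [|y]; last exact: Defs.pmf_ge0.
  apply: eq_ent => y; rewrite chE mulrC.
  have [->|hp] := mu0 (i, y); first by rewrite !mul0r.
  by rewrite (gAE _ _ hp) (gBE _ _ hp).
by apply: sums_toD; apply: sums_to_sum => i; apply: sums_to_delta; apply: ent_ge0 => j;
  exact: Defs.pmf_ge0.
Qed.

Section NoisyProtocol.
Variables (pi : protocol R X Y Z) (fA : X -> X) (fB : Y -> Y).
Variables (dA dB : R) (hA : 0 <= dA <= 1) (hB : 0 <= dB <= 1).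
Let pi' := noisy pi fA fB hA hB.

(** Summing [hres] over [t] gains [c], as [k] has total 1, and loses [d] times a residual bounded by
    [IC_residual]. The redirected part adds at most [d] to the error. *)
Lemma noisy_bounds d c (k : Pub pi * seq bool -> R) : 0 <= d -> 0 <= c ->
  performs pi f mu 0 -> sums_to k 1 ->
  (forall t, (1 - d) * residual (pi := pi) mu t + c * k t <= residual (pi := pi') mu t) ->
  (forall x y t, chan (pi := pi') x y t <=
     chan (pi := pi) x y t + d * chan (pi := pi) (fA x) (fB y) t) ->
  d <= 1 ->
  performs pi' f mu d /\
  IC pi' mu <= IC pi mu - c + d * (log2 #|X|%:R + log2 #|Y|%:R).
Proof.
move=> d0 c0 h0 k1 hres hch d1; split.
  apply/performsP.
  have /performsP[e he e0] := h0.
  have hs : sums_to (fun t => \sum_x \sum_y mu (x, y) * chan (pi := pi) (fA x) (fB y) t) 1.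
    rewrite -(dist_total mu); apply: sums_to_sum => x; apply: sums_to_sum => y.
    rewrite -[mu _ in X in sums_to _ X]mulr1.
    by apply: sums_toZ (chan_sums_to _ _ _); exact: Defs.pmf_ge0.
  have := sums_toD he (sums_toZ d0 hs); rewrite mulr1 => hd.
  suff [a ha ad] : exists2 a, sums_to (fun t => \sum_x \sum_y
      (wrong (pi := pi') f t x y)%:R * (mu (x, y) * chan (pi := pi') x y t)) a & a <= e + d.
    by exists a => //; lra.
  apply: sums_to_dominated hd => t.
    apply: sumr_ge0 => x _; apply: sumr_ge0 => y _.
    by apply: mulr_ge0 => //; exact: joint_ge0.
  rewrite mulr_sumr -big_split; apply: ler_sum => x _.
  rewrite mulr_sumr -big_split; apply: ler_sum => y _ /=.
  rewrite wrong_noisy; have m0 := Defs.pmf_ge0 mu (x, y).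
  have c1 := chan_ge0 (pi := pi) (fA x) (fB y) t.
  have hc := hch x y t.
  case: wrong; rewrite /= ?mul1r ?mul0r; last by rewrite add0r !mulr_ge0.
  apply: (le_trans (ler_wpM2l m0 hc)).
  by rewrite mulrDr mulrCA.
have [v [hv -> _]] := IC_residual pi' mu.
have [w [hw -> hwC]] := IC_residual pi mu.
have e0 : 0 <= 1 - d by lra.
have := sums_to_le (sums_toD (sums_toZ e0 hw) (sums_toZ c0 k1)) hv hres.
have : d * w <= d * (log2 #|X|%:R + log2 #|Y|%:R) by exact: ler_wpM2l.
lra.
Qed.

End NoisyProtocol.

(** The output on [t] is wrong for at least one of the two pairs, and zero error excludes [t]
    there. *)
Lemma conflict_chan pi x y x' y' t : performs pi f mu 0 ->
  0 < mu (x, y) -> 0 < mu (x', y') -> f x y != f x' y' ->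
  chan (pi := pi) x y t * chan x' y' t = 0.
Proof.
move=> h0 m1 m2 hf.
have [hw|hw] := boolP (wrong (pi := pi) f t x y).
  have /eqP := performs0_wrong h0 hw; rewrite mulf_eq0 gt_eqF //= => /eqP ->.
  by rewrite mul0r.
have [hw'|hw'] := boolP (wrong (pi := pi) f t x' y').
  have /eqP := performs0_wrong h0 hw'; rewrite mulf_eq0 gt_eqF //= => /eqP ->.
  by rewrite mulr0.
move: hw hw'; rewrite /wrong !negbK => /eqP e1 /eqP e2.
by rewrite -e1 -e2 eqxx in hf.
Qed.

(** Only the player whose input decides the conflict is noisy; the other gets the identity map and
    coin probability 0. Bob's case reduces to Alice's by [ent2_swap]. *)
Lemma noise_saves pi al d :
  performs pi f mu 0 -> 0 <= al -> (forall p, 0 < mu p -> al <= mu p) ->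
  0 < d -> d < 1 ->
  ((exists x x' y, [/\ 0 < mu (x, y), 0 < mu (x', y) & f x y != f x' y]) \/
   (exists x y y', [/\ 0 < mu (x, y), 0 < mu (x, y') & f x y != f x y'])) ->
  exists pi', performs pi' f mu d /\
    IC pi' mu <= IC pi mu - al * binent d + d * (log2 #|X|%:R + log2 #|Y|%:R).
Proof.
move=> h0 al0 hal d0 d1 hc.
have hd : 0 <= d <= 1 by rewrite !ltW.
have h00 : 0 <= (0 : R) <= 1 by rewrite lexx ler01.
have c0 : 0 <= al * binent d by rewrite mulr_ge0 // binent_ge0.
case: hc => [[x0 [x1 [y [m0 m1 hf]]]]|[x [y0 [y1 [m0 m1 hf]]]]].
  have x01 : x0 != x1 by apply: contraNneq hf => ->.
  exists (noisy pi (redirect x0 x1) id hd h00).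
  (* The restored uncertainty is distributed over transcripts as their law on [(x1, y)]. *)
  apply: (noisy_bounds (k := chan (pi := pi) x1 y)) => //; try exact: ltW.
  - exact: chan_sums_to.
  - move=> t.
    have -> : residual (pi := noisy pi (redirect x0 x1) id hd h00) mu t =
        ent2 (fun x y => mu (x, y) * ((1 - d) * chan (pi := pi) x y t +
                                      d * chan (pi := pi) (redirect x0 x1 x) y t)).
      congr ent2; apply/funext => x'; apply/funext => y'.
      by rewrite chan_noisy; congr (_ * _); ring.
    apply: (ent2_redirect (m := fun x y => mu (x, y))
      (K := fun x y => chan (pi := pi) x y t)) => //.
    + by move=> ? ?; exact: Defs.pmf_ge0.
    + by move=> ? ?; exact: chan_ge0.
    + exact: hal.
    + exact: hal.
    + exact: conflict_chan.
  - move=> x' y' t; rewrite chan_noisy.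
    have := chan_ge0 (pi := pi) x' y' t; nra.
have y01 : y0 != y1 by apply: contraNneq hf => ->.
exists (noisy pi id (redirect y0 y1) h00 hd).
apply: (noisy_bounds (k := chan (pi := pi) x y1)) => //; try exact: ltW.
- exact: chan_sums_to.
- move=> t.
  have -> : residual (pi := noisy pi id (redirect y0 y1) h00 hd) mu t =
      ent2 (fun y x => mu (x, y) * ((1 - d) * chan (pi := pi) x y t +
                                    d * chan (pi := pi) x (redirect y0 y1 y) t)).
    rewrite ent2_swap; congr ent2; apply/funext => x'; apply/funext => y'.
    by rewrite chan_noisy; congr (_ * _); ring.
  have -> : residual mu t = ent2 (fun y x => mu (x, y) * chan (pi := pi) x y t).
    by rewrite ent2_swap.
  apply: (ent2_redirect (m := fun y x => mu (x, y))
    (K := fun y x => chan (pi := pi) x y t)) => //.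
  + by move=> ? ?; exact: Defs.pmf_ge0.
  + by move=> ? ?; exact: chan_ge0.
  + exact: hal.
  + exact: hal.
  + exact: conflict_chan.
- move=> x' y' t; rewrite chan_noisy.
  have := chan_ge0 (pi := pi) x' y' t; nra.
Qed.

End Bounds.

(** * Numerical estimate of the cost of revealing *)

(** The disjunction is what [p = min (q, 1/2)] makes of [D <= q]. Either way the cross entropy of
    [D] against [p] is at most [h(p)], and [D <= 2 p <= 2 h(p)] controls the logarithms of [m] and
    [n]. *)
Lemma reveal_cost (R : realType) (D p : R) (m n : nat) :
  0 <= D -> D <= 1 -> D <= p \/ p = 2^-1 -> 0 < p -> p <= 2^-1 ->
  (0 < m)%N -> (0 < n)%N ->
  D * (log2 m%:R + log2 n%:R - 2 * log2 p + 2 * log2 (1 - p)) - 2 * log2 (1 - p)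
    <= 4 * m%:R * n%:R * binent p.
Proof.
move=> D0 D1 hDp p0 p2 m0 n0.
have hb := binent_ge_id p0 p2.
have lpq : log2 p <= log2 (1 - p) by apply: ler_log2 => //; lra.
have hD2 : D <= 2 * p by case: hDp; lra.
(* The left side is affine and nondecreasing in [D], with value [h(p)] at [D = p]; for [p = 1/2] it
   is constantly 1. *)
have hent : D * (- log2 p + log2 (1 - p)) - log2 (1 - p) <= binent p.
  case: hDp => [Dp|->].
    have : D * (- log2 p + log2 (1 - p)) <= p * (- log2 p + log2 (1 - p)).
      by apply: ler_wpM2r => //; lra.
    rewrite /binent; lra.
  rewrite /binent (_ : 1 - 2^-1 = 2^-1 :> R); last by lra.
  by rewrite log2V ?ltr0n // log2_2; lra.
have hl (k : nat) : (0 < k)%N -> log2 k%:R <= k%:R - 1 :> R.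
  by case: k => // k _; rewrite -[X in _ <= X - 1]natr1 addrK log2_natr_le.
have := hl _ m0; have := hl _ n0.
have : 1 <= m%:R :> R by rewrite ler1n.
have : 1 <= n%:R :> R by rewrite ler1n.
move: (m%:R) (n%:R) => {hl m0 n0} {}m {}n n1 m1 ln lm.
have l0 : 0 <= log2 m + log2 n by rewrite addr_ge0 // log2_ge0.
have h1 : D * (log2 m + log2 n) <= 2 * binent p * (log2 m + log2 n).
  by apply: ler_wpM2r => //; lra.
have h2 : 2 * binent p * (log2 m + log2 n) <= 2 * binent p * (m + n - 2).
  by apply: ler_wpM2l; lra.
(* This uses [m n >= m + n - 1]. *)
have h3 : binent p * (2 * (m + n) - 2) <= binent p * (4 * m * n).
  apply: ler_wpM2l; first by lra.
  have : 0 <= (m - 1) * (n - 1) by apply: mulr_ge0; lra.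
  lra.
have -> : 4 * m * n * binent p = binent p * (4 * m * n) by rewrite mulrC.
move: (binent p) (log2 p) (log2 (1 - p)) (log2 m) (log2 n) hent h1 h2 h3 {hb lpq hDp}
  => b lp lq a c hent h1 h2 h3.
clear -hent h1 h2 h3; lra.
Qed.

(** * Lower bound: removing the error by revealing suspect inputs *)

Section CheckedProtocol.
Context {R : realType} {X Y Z : finType}.
Variables (mu : dist R (X * Y)%type) (f : X -> Y -> Z) (pi : protocol R X Y Z).
Local Notation T := (Pub pi * seq bool)%type.

(** On the support [mu] is at least [alpha], so the channel mass of suspect pairs is at most the
    error divided by [alpha]. *)
Definition suspect (t : T) x y : bool := (0 < mu (x, y)) && wrong f t x y.

Definition revealA (t : T) : pred X :=
  exposedA (fun x y => mu (x, y)) (fun x y => chan x y t) (suspect t).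

Definition revealB (t : T) : pred Y :=
  exposedB (fun x y => mu (x, y)) (fun x y => chan x y t) (suspect t).

(** As soon as one player reveals, the other does too and [f x y] is output; if neither does, the
    original output stands. *)
Definition verify (t : T) : ctree X Y Z (PrivA pi) (PrivB pi) :=
  let z := Output X Y (PrivA pi) (PrivB pi) (leaf (comm t.1) t.2) in
  askA (enum (revealA t)) id
    (fun x => askB (enum Y) id (fun y => Output _ _ _ _ (f x y)) z)
    (askB (enum (revealB t)) id
      (fun y => askA (enum X) id (fun x => Output _ _ _ _ (f x y)) z) z).

Definition checked : protocol R X Y Z :=
  @Protocol R X Y Z _ _ _ (pub_dist pi) (privA_dist pi) (privB_dist pi)
    (fun r => extend (comm r) (fun s => verify (r, s))).

(* the transcript of [checked] in which neither player has to reveal their input *)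
Definition unrevealed (t : T) : T :=
  (t.1, t.2 ++ (nseq (size (enum (revealA t))) false ++
                nseq (size (enum (revealB t))) false)).

Lemma mem_revealA t x : (x \in enum (revealA t)) = revealA t x.
Proof. by rewrite mem_enum. Qed.

Lemma mem_revealB t y : (y \in enum (revealB t)) = revealB t y.
Proof. by rewrite mem_enum. Qed.

Lemma output_verify t a b x y : output a b x y (verify t) =
  if hidden (revealA t) (revealB t) x y then leaf (comm t.1) t.2 else f x y.
Proof.
rewrite /verify /hidden output_askA (mem_revealA t x).
case: (revealA t x); first by rewrite output_askB mem_enum.
rewrite output_askB (mem_revealB t y).
by case: (revealB t y); rewrite ?output_askA ?mem_enum.
Qed.

Lemma bits_verify t a b x y : hidden (revealA t) (revealB t) x y ->
  bits a b x y (verify t) = nseq (size (enum (revealA t))) false ++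
    nseq (size (enum (revealB t))) false.
Proof.
move=> /andP[hA hB]; rewrite /verify bits_askA (mem_revealA t x) (negPf hA).
by rewrite bits_askB (mem_revealB t y) (negPf hB) cats0.
Qed.

Lemma suspect_not_hidden t x y : suspect t x y ->
  ~~ hidden (revealA t) (revealB t) x y.
Proof.
move=> hs; rewrite /hidden negb_and !negbK.
case: (leP (\sum_y' mu (x, y') * chan x y' t) (\sum_x' mu (x', y) * chan x' y t)) => h.
  by apply/orP; left; apply/existsP; exists y; rewrite hs.
by apply/orP; right; apply/existsP; exists x; rewrite hs.
Qed.

(** A support pair that stays hidden is not suspect, so the original output is right; any other pair
    receives [f x y]. *)
Lemma performs_checked : performs checked f mu 0.
Proof.
apply/performsP; exists 0 => //.
apply: eq_sums_to (sums_to0 _) => t; rewrite big1 // => x _; rewrite big1 // => y _.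
have := Defs.pmf_ge0 mu (x, y); rewrite le_eqVlt => /predU1P[<-|m0].
  by rewrite mul0r mulr0.
have [->|hc] := eqVneq (chan (pi := checked) x y t) 0; first by rewrite !mulr0.
have [[[r a] b] <-] := chan_neq0 hc.
rewrite /wrong /= -output_leaf output_extend output_verify.
case: ifP => hh; last by rewrite eqxx mul0r.
have /negP hs : ~ suspect (r, bits (a : PrivA pi) (b : PrivB pi) x y (@comm _ _ _ _ pi r)) x y.
  by move=> /suspect_not_hidden; rewrite hh.
by move: hs; rewrite /suspect m0 /= /wrong /= => /negPf ->; rewrite mul0r.
Qed.

Lemma chan_checked t x y : hidden (revealA t) (revealB t) x y ->
  chan (pi := pi) x y t <= chan (pi := checked) x y (unrevealed t).
Proof.
move=> hh; apply: (le_Prob (rand_sums_to pi)) => -[[r a] b] /= ht; subst t.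
rewrite /trans /= bits_extend /unrevealed /=; congr (_, _ ++ _).
exact: bits_verify.
Qed.

(** The prefix property concerns strings that occur as transcripts, so [unrevealed] is shown
    injective on this set. *)
Definition possible : set T := [set t | exists x y, chan (pi := pi) x y t != 0].

Lemma unrevealed_inj : set_inj possible unrevealed.
Proof.
move=> t t' /set_mem[x [y /chan_neq0[[[r a] b] <-]]].
move=> /set_mem[x' [y' /chan_neq0[[[r' a'] b'] <-]]].
rewrite /unrevealed /trans /= => -[er h]; subst r'.
by rewrite (bits_prefix_free h).
Qed.

(** Hidden pairs with transcript [t] continue to [unrevealed t], and [ent2] is monotone; for
    impossible [t] the left side vanishes. *)
Lemma residual_checked t :
  ent2 (fun x y => (hidden (revealA t) (revealB t) x y)%:R * (mu (x, y) * chan x y t))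
  <= (t \in possible)%:R * residual (pi := checked) mu (unrevealed t).
Proof.
have [ht|ht] := boolP (t \in possible).
  rewrite mul1r; apply: le_ent2 => x y.
    by apply: mulr_ge0 => //; exact: joint_ge0.
  case: (boolP (hidden _ _ x y)) => hh; last by rewrite mul0r joint_ge0.
  by rewrite mul1r ler_wpM2l ?Defs.pmf_ge0 // chan_checked.
rewrite mul0r (_ : (fun x y => _) = (fun x y => 0 * (fun _ _ => 0) x y)).
  by rewrite ent2_scale // mul0r.
apply/funext => x; apply/funext => y; rewrite mul0r.
have [->|hc] := eqVneq (chan x y t) 0; first by rewrite !mulr0.
by exfalso; move/negP: ht; apply; apply: mem_set; exists x, y.
Qed.

(** [D] is the probability that anything is revealed. Writing the error as [al * q ^+ 2] makes each
    of the two AM-GM terms at most [q / 2]. *)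
Lemma IC_checked al q p : 0 < al -> (forall w, 0 < mu w -> al <= mu w) ->
  0 < q -> performs pi f mu (al * q ^+ 2) -> 0 < p -> p < 1 ->
  exists D, [/\ 0 <= D, D <= 1, D <= q &
    IC checked mu <= IC pi mu
      + D * (log2 #|X|%:R + log2 #|Y|%:R - 2 * log2 p + 2 * log2 (1 - p))
      - 2 * log2 (1 - p)].
Proof.
move=> al0 hal q0 /performsP[e he ele] p0 p1.
pose M (t : T) x y := mu (x, y) * chan (pi := pi) x y t.
have M0 t x y : 0 <= M t x y by exact: joint_ge0.
pose Dt t := \sum_x \sum_y (~~ hidden (revealA t) (revealB t) x y)%:R * M t x y.
have Dt0 t : 0 <= Dt t.
  by apply: sumr_ge0 => x _; apply: sumr_ge0 => y _; exact: mulr_ge0.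
have hmass := joint_mass_sums_to pi mu.
have [D hD D1] : exists2 D, sums_to Dt D & D <= 1.
  apply: sums_to_dominated hmass => // t.
  apply: ler_sum => x _; apply: ler_sum => y _; apply: ler_piMl => //.
  by case: hidden.
have D0 : 0 <= D by exact: sums_to_ge0 hD.
pose Q t := \sum_x \sum_y \sum_x' \sum_y' mu (x, y') * mu (x', y) * chan (pi := pi) x' y' t.
have hQ : sums_to Q 1.
  (* The fourfold sum factors into two copies of the total mass of [mu]. *)
  have -> : 1 = \sum_x \sum_y \sum_x' \sum_y' mu (x, y') * mu (x', y) :> R.
    rewrite -[LHS](mulr1 1) -{1}(dist_total mu) mulr_suml; apply: eq_bigr => x _.
    rewrite -(dist_total mu) exchange_big mulr_sumr; apply: eq_bigr => y _.
    rewrite mulrC mulr_suml; apply: eq_bigr => x' _.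
    by rewrite mulr_sumr; apply: eq_bigr => y' _; rewrite mulrC.
  do 4! apply: sums_to_sum => ?.
  rewrite -[X in sums_to _ X]mulr1; apply: sums_toZ (chan_sums_to _ _ _).
  by rewrite mulr_ge0 ?Defs.pmf_ge0.
have q1 : 0 <= q^-1 / 2 * al^-1 by rewrite !mulr_ge0 ?invr_ge0 ?ltW.
have q2 : 0 <= q / 2 by rewrite mulr_ge0 ?invr_ge0 ?ltW.
have Dq : D <= q.
  have hle t : Dt t <= q^-1 / 2 * al^-1 * (\sum_x \sum_y (wrong f t x y)%:R * M t x y)
      + q / 2 * Q t.
    have := @revealed_mass _ X Y (fun x y => mu (x, y)) (fun x y => chan (pi := pi) x y t)
      (suspect t) (fun _ _ => Defs.pmf_ge0 mu _) (fun _ _ => chan_ge0 _ _ _)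
      (fun _ _ _ _ => chan_rect _ _ _ _ _) q q0.
    move=> /le_trans; apply; rewrite [Q t * _]mulrC lerD2r mulrC -mulrA.
    apply: ler_wpM2l; first by rewrite !mulr_ge0 ?invr_ge0 ?ltW.
    rewrite mulr_sumr; apply: ler_sum => x _; rewrite mulr_sumr; apply: ler_sum => y _.
    rewrite /suspect; case: (boolP (0 < _)) => hm; last first.
      by rewrite mul0r; apply: mulr_ge0; [rewrite invr_ge0 ltW|exact: mulr_ge0].
    rewrite mulrCA /=; apply: ler_wpM2l => //.
    rewrite /M mulrA ler_peMl ?chan_ge0 // mulrC ler_pdivlMr // mul1r.
    exact: hal.
  have := sums_to_le hD (sums_toD (sums_toZ q1 he) (sums_toZ q2 hQ)) hle.
  move=> /le_trans; apply.
  have h1 : q^-1 / 2 * al^-1 * e <= q / 2.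
    apply: (le_trans (ler_wpM2l q1 ele)).
    rewrite (_ : q^-1 / 2 * al^-1 * (al * q ^+ 2) = q / 2) //; field.
    by rewrite !gt_eqF.
  lra.
have [v [hv hIC _]] := IC_residual pi mu.
have [v' [hv' hIC' _]] := IC_residual checked mu.
(* [w] keeps only the transcripts [unrevealed t]; the remaining residuals are nonnegative. *)
have [w hw wv'] := sums_to_sub unrevealed_inj hv'.
exists D; split=> //; rewrite hIC hIC'.
(* the coefficient of D may be negative: its negative part goes to the other side *)
have lp : 0 <= - log2 p by rewrite oppr_ge0 log2_le0 // ltW.
have lq : 0 <= - log2 (1 - p).
  by rewrite oppr_ge0 log2_le0 ?subr_gt0 // gerBl ltW.
pose cp := log2 #|X|%:R + log2 #|Y|%:R + 2 * - log2 p : R.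
have cp0 : 0 <= cp by rewrite !addr_ge0 ?log2_card_ge0 // mulr_ge0.
pose cq := 2 * - log2 (1 - p).
have cq0 : 0 <= cq by rewrite mulr_ge0.
have hl := sums_toD hv (sums_toZ cq0 hD).
have hr := sums_toD (sums_toD hw (sums_toZ cp0 hD)) (sums_toZ cq0 hmass).
have : v + cq * D <= w + cp * D + cq * 1.
  apply: sums_to_le hl hr _ => t.
  have := ent2_reveal (revealA t) (revealB t) (M0 t) p0 p1.
  have := residual_checked t; rewrite -/(M _ _ _) -/(Dt t) /residual -/(M t) /cp /cq.
  move: (Dt t) (ent2 _) (_ * ent2 _) (ent2 (M t)) (\sum_x \sum_y M t x y).
  move: (log2 #|X|%:R) (log2 #|Y|%:R) (log2 p) (log2 (1 - p)); clear; move=> *; lra.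
move: wv'; rewrite /cp /cq; move: (ent2 _) (log2 #|X|%:R) (log2 #|Y|%:R) (log2 p) (log2 (1 - p)).
clear; move=> *; lra.
Qed.

Lemma checked_bound al eps : 0 < al -> (forall w, 0 < mu w -> al <= mu w) ->
  0 < eps -> performs pi f mu eps ->
  IC checked mu <= IC pi mu + 4 * #|X|%:R * #|Y|%:R * binent_hat (Num.sqrt (eps / al)).
Proof.
move=> al0 hal e0 hp; set q := Num.sqrt _.
have ea0 : 0 < eps / al by rewrite divr_gt0.
have q0 : 0 < q by rewrite sqrtr_gt0.
have hq : eps = al * q ^+ 2 by rewrite sqr_sqrtr ?ltW // mulrC divfK // gt_eqF.
(* The point at which [binent_hat] evaluates [binent]. *)
set p := Num.min q 2^-1.
have p0 : 0 < p by rewrite lt_min q0 invr_gt0 ltr0n.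
have p2 : p <= 2^-1 by rewrite ge_min lexx orbT.
have p1 : p < 1 by apply: (le_lt_trans p2); rewrite invf_lt1 ?ltr1n.
rewrite hq in hp.
have [D [D0 D1 Dq hIC]] := IC_checked al0 hal q0 hp p0 p1.
apply: (le_trans hIC); rewrite -addrA lerD2l /binent_hat -/p.
have hDp : D <= p \/ p = 2^-1.
  by rewrite /p; case: (leP q 2^-1) => _; [left|right].
have [[x y] _] := dist_inhabited mu.
have nX : (0 < #|X|)%N by apply/card_gt0P; exists x.
have nY : (0 < #|Y|)%N by apply/card_gt0P; exists y.
have := reveal_cost D0 D1 hDp p0 p2 nX nY.
by rewrite addrAC -addrA.
Qed.

End CheckedProtocol.

(** * The infimum over protocols *)

Section Infimum.
Context {R : realType} {X Y Z : finType}.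
Variables (mu : dist R (X * Y)%type) (f : X -> Y -> Z).
Implicit Types pi : protocol R X Y Z.

Lemma min_supp_gt0 : 0 < min_supp mu.
Proof. by apply/bigmin_gtP; split. Qed.

Lemma min_supp_le1 : min_supp mu <= 1.
Proof. exact: bigmin_le_id. Qed.

Lemma min_supp_le w : 0 < mu w -> min_supp mu <= mu w.
Proof. exact: bigmin_le_cond. Qed.

Lemma ICf_le pi eps : performs pi f mu eps -> ICf mu f mu eps <= IC pi mu.
Proof.
move=> hp; apply: ge_inf; last by exists pi.
(* A lower bound for all information costs, by [IC_residual]. *)
exists (ent2 (fun x y => mu (x, y)) - (log2 #|X|%:R + log2 #|Y|%:R)) => v [pi' [_ ->]].
by have [w [_ -> hw]] := IC_residual pi' mu; rewrite lerD2l lerN2.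
Qed.

Lemma ICf_ge pi0 eps c : performs pi0 f mu eps ->
  (forall pi, performs pi f mu eps -> c <= IC pi mu) -> c <= ICf mu f mu eps.
Proof.
move=> h0 h; apply: lb_le_inf; first by exists (IC pi0 mu), pi0.
by move=> v [pi [hp ->]]; exact: h.
Qed.

(** The infimum of the empty set is 0 by convention, so positivity forces a protocol to exist. *)
Lemma ICf_gt0_performs eps : 0 < ICf mu f mu eps -> exists pi, performs pi f mu eps.
Proof.
move=> h; apply: contrapT => hn; move: h; rewrite /ICf (_ : [set v | _] = set0).
  by rewrite inf0 ltxx.
by apply/seteqP; split=> // v [pi [hp _]]; apply: hn; exists pi.
Qed.

(** Otherwise [silent_protocol] would bring the infimum down to at most 0. *)
Lemma ICf_gt0_conflict : 0 < ICf mu f mu 0 ->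
  (exists x x' y, [/\ 0 < mu (x, y), 0 < mu (x', y) & f x y != f x' y]) \/
  (exists x y y', [/\ 0 < mu (x, y), 0 < mu (x, y') & f x y != f x y']).
Proof.
move=> h; apply: contrapT => /not_orP[hA hB].
have [| |pi [hp h0]] := @silent_protocol R X Y Z mu f.
- move=> x x' y m m'; apply/eqP/negPn/negP => hf; apply: hA.
  by exists x, x', y.
- move=> x y y' m m'; apply/eqP/negPn/negP => hf; apply: hB.
  by exists x, y, y'.
by have := ICf_le hp; rewrite h0 leNgt h.
Qed.

Lemma performsW pi e e' : e <= e' -> performs pi f mu e -> performs pi f mu e'.
Proof. by move=> ee h; apply: le_trans ee. Qed.

End Infimum.

(** * Assembly of the two bounds *)

Theorem mainTheorem5 (R : realType) (X Y Z : finType)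
    (mu : dist R (X * Y)%type) (f : X -> Y -> Z)
    (hIC : 0 < ICf mu f mu 0) (eps : R) (heps : 0 <= eps <= 1) :
  let alpha := min_supp mu in
  ICf mu f mu 0
    - 4 * #|X|%:R * #|Y|%:R * binent_hat (Num.sqrt (eps / alpha))
    <= ICf mu f mu eps /\
  ICf mu f mu eps
    <= ICf mu f mu 0 - alpha ^+ 2 / 4 * binent (eps * alpha / 4)
       + 3 * eps * log2 (#|{: X * Y}|%:R).
Proof.
move=> alpha.
have [pi0 h0] := ICf_gt0_performs hIC.
have a0 : 0 < alpha := min_supp_gt0 mu.
have a1 : alpha <= 1 := min_supp_le1 mu.
have ha : forall w, 0 < mu w -> alpha <= mu w := @min_supp_le _ _ _ mu.
(* At [eps = 0] both corrections vanish; what remains has [0 < eps], as the noise and the weight [q]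
   require. *)
case/andP: heps; rewrite le_eqVlt => /predU1P[<- _|e0 e1].
  rewrite /binent_hat !mul0r sqrtr0 min_l ?invr_ge0 ?ler0n //.
  by rewrite binent0 !mulr0 mul0r addr0 subr0.
split.
  (* Checking turns any protocol of error [eps] into a zero-error one. *)
  apply: (ICf_ge (performsW (ltW e0) h0)) => pi hp.
  have := ICf_le (performs_checked mu f pi).
  have := checked_bound a0 ha e0 hp.
  by move=> h1 h2; rewrite lerBlDr; exact: le_trans h2 h1.
pose d := eps * alpha / 4.
have d0 : 0 < d by rewrite !mulr_gt0 ?invr_gt0 ?ltr0n.
have ea : eps * alpha <= eps by rewrite ler_piMr // ltW.
have d4 : d * 4 = eps * alpha by rewrite divfK ?pnatr_eq0.
have d1 : d < 1 by lra.
have de : d <= eps by lra.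
have hconf := ICf_gt0_conflict hIC.
rewrite card_prod natrM log2M ?ltr0n; last 2 first.
- by case: (dist_inhabited mu) => -[x y] _; apply/card_gt0P; exists x.
- by case: (dist_inhabited mu) => -[x y] _; apply/card_gt0P; exists y.
have l0 : 0 <= log2 #|X|%:R + log2 #|Y|%:R :> R by rewrite addr_ge0 ?log2_card_ge0.
(* The noise gains [alpha * binent d], at least the stated gain because [alpha <= 1]. *)
have hs : alpha ^+ 2 / 4 * binent d <= alpha * binent d.
  apply: ler_wpM2r; first by apply: binent_ge0; rewrite !ltW.
  have : alpha ^+ 2 <= alpha by rewrite expr2 ler_piMr // ltW.
  lra.
have ht : d * (log2 #|X|%:R + log2 #|Y|%:R) <= 3 * eps * (log2 #|X|%:R + log2 #|Y|%:R).
  by apply: ler_wpM2r => //; lra.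
(* With the corrections on the left, a bound for every zero-error [pi] suffices. *)
rewrite -lerBlDr lerBrDr; apply: (ICf_ge h0) => pi hp.
have [pi' [hp' hIC']] := noise_saves hp (ltW a0) ha d0 d1 hconf.
have hle := le_trans (ICf_le (performsW de hp')) hIC'.
rewrite -lerBrDr lerBlDr; apply: (le_trans hle).
by apply: lerD => //; apply: lerB.
Qed.
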